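(* Let $X$ be a proper metric space with $\operatorname{trasind} X<\infty$ (i.e. $\operatorname{trasind}X\le\alpha$ for some ordinal $\alpha$). Then $\operatorname{asind} X<\infty$.
   Context: A metric space is proper if every closed ball is compact; each such space $X$ has a fixed base point $x_0$, with metric $d$. A map $\phi:X\to[0,1]$ is slowly oscillating if for every $r>0$ and $\varepsilon>0$ there is $D>0$ with $\operatorname{diam}\phi(B_r(x))<\varepsilon$ whenever $d(x,x_0)\ge D$. The Higson compactification $cX$ is the closure of the image of $X$ under $x\mapsto(\phi(x))_{\phi\in C_h(X)}\in[0,1]^{C_h(X)}$, where $C_h(X)$ is the set of continuous slowly oscillating maps $X\to[0,1]$; the Higson corona is $\nu X=cX\setminus X$. For $C\subset X$, $C'=\operatorname{cl}_{cX}C\cap\nu X$. A partition between disjoint closed sets $P,Q$ of a space $Z$ is a set $S\subset Z$ such that $Z\setminus S=U_1\cup U_2$ with $U_1,U_2$ disjoint open, $P\subset U_1$, $Q\subset U_2$. For $x\in\nu X$ and $A\subset X$ with $x\notin A'$, an asymptotic separator for $x$ and $A$ is $C\subset X$ with $C'$ a partition between $\{x\}$ and $A'$ in $\nu X$. $\operatorname{asind}X=-1$ iff $X$ is bounded; $\operatorname{asind}X\le n$ iff for every $x\in\nu X$ and $A\subset X$ with $x\notin A'$ there is an asymptotic separator $C$ for $x$ and $A$ with $\operatorname{asind}C\le n-1$; $\operatorname{asind}X=\infty$ if $\operatorname{asind}X\le n$ for no $n$. The transfinite version: $\operatorname{trasind} X=-1$ iff $X$ is bounded; for an ordinal $\alpha$,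 $\operatorname{trasind} X\le\alpha$ iff for every $x\in\nu X$ and $A\subset X$ with $x\notin A'$ there is an asymptotic separator $C$ for $x$ and $A$ with $\operatorname{trasind} C\le\beta$ for some $\beta<\alpha$; $\operatorname{trasind} X=\infty$ if $\operatorname{trasind} X\le\alpha$ holds for no ordinal $\alpha$. (Subsets carry the restricted metric.) *)

(* Defs.v *)
From HB Require Import structures.
From mathcomp Require Import all_boot all_order all_algebra.
From mathcomp Require Import all_classical all_reals all_analysis.
From mathcomp Require Import Rstruct Rstruct_topology.
From Stdlib Require Import Rdefinitions.

Set Implicit Arguments.
Unset Strict Implicit.
Unset Printing Implicit Defensive.

Import Order.TTheory GRing.Theory Num.Theory.
Local Open Scope classical_set_scope.
Local Open Scope ring_scope.

Notation R := Rdefinitions.R.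

Record metric := Metric {
  mcarrier :> Type;
  mdist : mcarrier -> mcarrier -> R;
  mdist_eq0 : forall x y, mdist x y = 0 <-> x = y;
  mdist_sym : forall x y, mdist x y = mdist y x;
  mdist_tri : forall x y z, mdist x z <= mdist x y + mdist y z }.

Definition sub (M : metric) (C : set M) : metric.
Proof.
refine (@Metric {x : M | C x} (fun a b => mdist (sval a) (sval b)) _ _ _).
- move=> [x hx] [y hy] /=; split.
  + move=> /mdist_eq0 e; subst y; by rewrite (Prop_irrelevance hx hy).
  + by move=> [->]; apply/mdist_eq0.
- by move=> a b; apply: mdist_sym.
- by move=> a b c; apply: mdist_tri.
Defined.

Definition mbounded (M : metric) : Prop :=
  exists r : R, forall x y : M, mdist x y <= r.

Definition mopen (M : metric) (U : set M) : Prop :=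
  forall x, U x -> exists2 r : R, 0 < r & forall y, mdist x y < r -> U y.

Definition mcompact (M : metric) (K : set M) : Prop :=
  forall F : set (set M), (forall U, F U -> mopen U) ->
    K `<=` bigcup F id ->
    exists s : seq (set M), (forall U, U \in s -> F U) /\
      K `<=` (fun x => exists2 U, U \in s & U x).

Definition closed_ball (M : metric) (x : M) (r : R) : set M :=
  [set y | mdist x y <= r].

Definition mproper (M : metric) : Prop :=
  forall (x : M) (r : R), mcompact (closed_ball x r).

Definition mcontinuous (M : metric) (f : M -> R) : Prop :=
  forall (x : M) (e : R), 0 < e ->
    exists2 d : R, 0 < d & forall y, mdist x y < d -> `|f x - f y| < e.

(** slowly oscillating (stated for every choice of base point x0; the notion
    does not depend on the base point) *)
Definition slowly_oscillating (M : metric) (f : M -> R) : Prop :=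
  forall (x0 : M) (r e : R), 0 < r -> 0 < e ->
    exists D : R, forall x : M, D <= mdist x x0 ->
      forall y z, mdist x y < r -> mdist x z < r -> `|f y - f z| < e.

Definition is_higson_fun (M : metric) (f : M -> R) : Prop :=
  [/\ mcontinuous f, (forall x, 0 <= f x <= 1) & slowly_oscillating f].

Definition Ch (M : metric) := {f : M -> R | is_higson_fun f}.

Definition hspace (M : metric) := {ptws Ch M -> R}.

Definition hemb (M : metric) (x : M) : hspace M := fun phi => sval phi x.

Definition cube (M : metric) : set (hspace M) :=
  [set p | forall phi, 0 <= p phi <= 1].
Arguments cube M : clear implicits.

Definition higson_cpt (M : metric) : set (hspace M) :=
  closure (range (@hemb M)) `&` cube M.
Arguments higson_cpt M : clear implicits.

Definition corona (M : metric) : set (hspace M) :=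
  higson_cpt M `\` range (@hemb M).
Arguments corona M : clear implicits.

Definition trace (M : metric) (C : set M) : set (hspace M) :=
  (closure (@hemb M @` C) `&` higson_cpt M) `&` corona M.

Definition rel_open (M : metric) (Z U : set (hspace M)) : Prop :=
  exists2 O, open O & U = O `&` Z.

Definition partition_between (M : metric) (Z S P Q : set (hspace M)) : Prop :=
  S `<=` Z /\
  exists U1 U2, [/\ rel_open Z U1, rel_open Z U2, U1 `&` U2 = set0,
    Z `\` S = U1 `|` U2 & P `<=` U1 /\ Q `<=` U2].

Definition asymptotic_separator (M : metric) (x : hspace M) (A C : set M) : Prop :=
  partition_between (corona M) (trace C) [set x] (trace A).

(** asind_le n X  means  asind X <= n - 1  (so asind_le 0 X is asind X = -1) *)
Fixpoint asind_le (n : nat) : metric -> Prop :=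
  match n with
  | O => fun M => mbounded M
  | S k => fun M =>
      forall (x : hspace M) (A : set M), corona M x -> ~ trace A x ->
        exists C : set M, asymptotic_separator x A C /\ asind_le k (sub C)
  end.

(** Ordinals are represented by elements of well-ordered types. *)
Definition well_order (W : Type) (lt : W -> W -> Prop) : Prop :=
  [/\ well_founded lt,
      (forall a b c, lt a b -> lt b c -> lt a c) &
      (forall a b, lt a b \/ a = b \/ lt b a)].

(** trasind X <= alpha, by transfinite recursion on alpha; "trasind C <= beta
    for some beta < alpha" allows beta = -1, i.e. C bounded. *)
Definition trasind_le (W : Type) (lt : W -> W -> Prop) (wf : well_founded lt)
  : W -> metric -> Prop :=
  Fix wf (fun _ => metric -> Prop)
    (fun alpha rec M =>
       forall (x : hspace M) (A : set M), corona M x -> ~ trace A x ->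
         exists C : set M, asymptotic_separator x A C /\
           (mbounded (sub C) \/
            exists beta (h : lt beta alpha), rec beta h (sub C))).

Definition trasind_finite (M : metric) : Prop :=
  exists (W : Type) (lt : W -> W -> Prop) (wo : well_order lt) (alpha : W),
    trasind_le (let: And3 wf _ _ := wo in wf) alpha M.

(* Main.v *)
From mathcomp Require Import all_boot all_order all_algebra.
From mathcomp Require Import all_classical all_reals all_analysis.
From mathcomp Require Import Rstruct Rstruct_topology lra zify ring.
Require Import Defs.

Set Implicit Arguments.
Unset Strict Implicit.
Unset Printing Implicit Defensive.

Import Order.TTheory GRing.Theory Num.Theory.
Local Open Scope classical_set_scope.
Local Open Scope ring_scope.

(** Two sets have disjoint traces iff they are asymptotically disjoint, and a
    corona point is the limit of an ultrafilter without bounded sets; this turns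
    asind into a coarse dimension [cind] of the subsets of X, which is shown to
    be monotone.

    By transfinite induction one may assume that every point of the corona can be
    separated from every set not adherent to it by a set of finite dimension.
    If the dimension were unbounded at points z <> x arbitrarily close to
    some x, one could choose such points z_k with asymptotically disjoint
    neighbourhoods N_k and sets A_k, disjoint from N_k, such that no separator
    between z_k and A_k has dimension less than k. A separator of finite
    dimension between a limit of the z_k and the complement of the union of the
    N_k would then cut down to separators of bounded dimension between z_k and
    A_k for infinitely many k. So the local dimension is bounded on a punctured
    neighbourhood of each point, hence, by compactness, outside a finite set,
    and the points of that finite set can be separated from anything by shells
    which avoid it. *)

(** * Asymptotic disjointness and the coarse dimension *)

Lemma ultraC (Z : Type) (u : set_system Z) (S : set Z) :
  UltraFilter u -> ~ u S -> u (~` S).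
Proof. by move=> U; case: (in_ultra_setVsetC S U). Qed.

Lemma ultraU (Z : Type) (u : set_system Z) (S T : set Z) :
  UltraFilter u -> u (S `|` T) -> u S \/ u T.
Proof.
move=> U h; have [|nS] := pselect (u S); first by left.
right; have nSu := ultraC U nS.
have : u ((S `|` T) `&` ~` S) by exact: filterI.
by apply: filterS => x [[|]].
Qed.

(** If no member of [F] contained [S], the differences of [S] with members of [F] would generate a
    proper filter, and an ultrafilter extending it would contain no member of [F]. This is the form
    in which compactness is used below. *)
Lemma ultra_compact (Z : Type) (F : set (set Z)) (S : set Z) :
  F set0 -> (forall A B, F A -> F B -> F (A `|` B)) ->
  (forall v : set_system Z, UltraFilter v -> v S -> exists2 T, F T & v T) ->
  exists2 T, F T & S `<=` T.
Proof.
move=> F0 FU cov; apply: contrapT => nex.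
pose G : set_system Z := [set H | exists2 T, F T & S `\` T `<=` H].
have PG : ProperFilter G.
  split; first by move=> [T FT sT]; apply: nex; exists T => // x Sx;
    apply: contrapT => nTx; exact: (sT x).
  split; first by exists set0.
    move=> H K [T FT sT] [T' FT' sT']; exists (T `|` T'); first exact: FU.
    by move=> x [Sx /not_orP[nT nT']]; split; [apply: sT|apply: sT'].
  by move=> H K HK [T FT sT]; exists T => //; apply: subset_trans HK.
have [v [Uv Gv]] := ultraFilterLemma PG.
have [|T FT vT] := cov v Uv; first by apply: Gv; exists set0 => // x [].
have vT' : v (~` T) by apply: Gv; exists T => // x [].
have : v (T `&` ~` T) by exact: filterI.
by rewrite setICr; exact: filter_not_empty.
Qed.

Lemma nat_ge (r : R) : exists m : nat, r <= m%:R.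
Proof.
exists (Num.bound `|r|); apply: le_trans (ler_norm r) _.
by apply/ltW/archi_boundP.
Qed.

Lemma ultra_intro (Z : Type) (F : set_system Z) :
  ProperFilter F -> (forall S, F S \/ F (~` S)) -> UltraFilter F.
Proof.
move=> PF dec; split => // G PG FG; apply/seteqP; split => // S GS.
have [//|/FG GnS] := dec S.
have : G (S `&` ~` S) by exact: filterI.
by rewrite setICr => /filter_not_empty.
Qed.

Lemma ultra_push (Z Z' : Type) (f : Z -> Z') (u : set_system Z) :
  UltraFilter u -> UltraFilter [set S | u (f @^-1` S)].
Proof.
by move=> U; apply: ultra_intro => S; have := in_ultra_setVsetC (f @^-1` S) U.
Qed.

(** * Bounded sets, asymptotic disjointness and separators *)

Section Coarse.
Variable X : metric.
Implicit Types (A B S T E Y : set X) (u v w : set_system X).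

Lemma mdistxx (x : X) : mdist x x = 0.
Proof. exact/mdist_eq0. Qed.

Lemma mdist_ge0 (x y : X) : 0 <= mdist x y.
Proof.
have := mdist_tri x y x; rewrite mdistxx (mdist_sym y x); lra.
Qed.

Lemma mdist_tri3 (a b c d : X) :
  mdist a d <= mdist a b + mdist b c + mdist c d.
Proof.
have := mdist_tri a b d; have := mdist_tri b c d; lra.
Qed.

Definition bounded_set S := exists r : R, forall a b, S a -> S b -> mdist a b <= r.

Definition asdisjoint A B :=
  forall r : R, bounded_set [set a | A a /\ exists2 b, B b & mdist a b <= r].

Lemma bounded_setS S T : S `<=` T -> bounded_set T -> bounded_set S.
Proof. by move=> ST [r h]; exists r => a b /ST ? /ST ?; exact: h. Qed.

Lemma bounded_set0 : bounded_set set0.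
Proof. by exists 0. Qed.

Lemma bounded_set_ball (x : X) S (r : R) :
  (forall a, S a -> mdist x a <= r) -> bounded_set S.
Proof.
move=> h; exists (r + r) => a b /h Sa /h Sb.
have := mdist_tri a x b; rewrite (mdist_sym a x); lra.
Qed.

Lemma bounded_set_in_ball (x : X) S :
  bounded_set S -> exists r : R, forall a, S a -> mdist x a <= r.
Proof.
move=> [r h]; have [[b Sb]|nS] := pselect (exists b, S b).
  exists (mdist x b + r) => a Sa; have := mdist_tri x b a; have := h _ _ Sb Sa; lra.
by exists 0 => a Sa; case: nS; exists a.
Qed.

Lemma bounded_setU S T : bounded_set S -> bounded_set T -> bounded_set (S `|` T).
Proof.
have [[x _]|nX] := pselect (exists x : X, True); last first.
  by move=> _ _; exists 0 => a; case: nX; exists a.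
move=> /(bounded_set_in_ball x)[r hr] /(bounded_set_in_ball x)[s hs].
apply: (@bounded_set_ball x _ (Num.max r s)) => a [/hr|/hs] h;
  by rewrite le_max h ?orbT.
Qed.

Lemma asdisjointSS A A' B B' :
  A' `<=` A -> B' `<=` B -> asdisjoint A B -> asdisjoint A' B'.
Proof.
move=> sA sB h r; apply: bounded_setS (h r) => a [/sA Aa [b /sB Bb ab]].
by split => //; exists b.
Qed.

Lemma asdisjointSl A A' B : A' `<=` A -> asdisjoint A B -> asdisjoint A' B.
Proof. by move=> sA; apply: asdisjointSS. Qed.

Lemma asdisjointSr A B B' : B' `<=` B -> asdisjoint A B -> asdisjoint A B'.
Proof. by move=> sB; apply: asdisjointSS. Qed.

Lemma asdisjoint_sym A B : asdisjoint A B -> asdisjoint B A.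
Proof.
move=> h r; have [s hs] := h r; exists (r + s + r).
move=> b b' [Bb [a Aa ab]] [Bb' [a' Aa' ab']].
have aa' : mdist a a' <= s.
  by apply: hs; split => //; [exists b|exists b'] => //; rewrite mdist_sym.
have := mdist_tri3 b a a' b'; rewrite (mdist_sym a' b'); lra.
Qed.

Lemma asdisjointUl A A' B :
  asdisjoint A B -> asdisjoint A' B -> asdisjoint (A `|` A') B.
Proof.
move=> h h' r; apply: bounded_setS (bounded_setU (h r) (h' r)).
by move=> a [[Aa|Aa] ?]; [left|right].
Qed.

Lemma asdisjointUr A B B' :
  asdisjoint A B -> asdisjoint A B' -> asdisjoint A (B `|` B').
Proof.
by move=> /asdisjoint_sym h /asdisjoint_sym h'; apply/asdisjoint_sym/asdisjointUl.
Qed.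

Lemma bounded_asdisjointl A B : bounded_set A -> asdisjoint A B.
Proof. by move=> h r; apply: bounded_setS h => a []. Qed.

Lemma bounded_asdisjointr A B : bounded_set B -> asdisjoint A B.
Proof. by move=> /bounded_asdisjointl h; apply/asdisjoint_sym/h. Qed.

Lemma asdisjoint0r A : asdisjoint A set0.
Proof. exact/bounded_asdisjointr/bounded_set0. Qed.

Lemma asdisjoint_bounded A B S :
  S `<=` A -> S `<=` B -> asdisjoint A B -> bounded_set S.
Proof.
move=> SA SB /(_ 0); apply: bounded_setS => a Sa; split; first exact: SA.
by exists a; [exact: SB|rewrite mdistxx].
Qed.

(** Normality of the corona in coarse terms: [T] consists of the points that are, up to 1, at least
    as close to [A] as to [B]. *)
Lemma asdisjoint_interp A B : asdisjoint A B ->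
  exists T, [/\ A `<=` T, asdisjoint A (~` T) & asdisjoint T B].
Proof.
move=> h.
exists [set x | exists2 a, A a & forall b, B b -> mdist x a <= mdist x b + 1].
split.
- by move=> a Aa; exists a => // b _; rewrite mdistxx; have := mdist_ge0 a b; lra.
- move=> r; apply: bounded_setS (h (r + r)) => a [Aa [x nTx ax]]; split => //.
  apply: contra_notP nTx => nb; exists a => // b Bb.
  have [//|lt] := leP (mdist x a) (mdist x b + 1).
  case: nb; exists b => //.
  have := mdist_tri a x b; move: ax lt; rewrite (mdist_sym x a); lra.
- move=> r; have [s hs] := h (r + 1 + r).
  exists (s + (r + 1) + (r + 1)).
  have H x : (exists2 a, A a & forall b, B b -> mdist x a <= mdist x b + 1) /\
      (exists2 b, B b & mdist x b <= r) ->
      exists a, [/\ A a, mdist x a <= r + 1 &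
        (exists2 b, B b & mdist a b <= r + 1 + r)].
    move=> [[a Aa hA] [b Bb xb]]; exists a; have := hA _ Bb => xa.
    split => //; first lra; exists b => //.
    have := mdist_tri a x b; rewrite (mdist_sym a x); lra.
  move=> x y /H[a [Aa xa ab]] /H[b [Ab yb bb]].
  have := hs _ _ (conj Aa ab) (conj Ab bb).
  have := mdist_tri3 x a b y; rewrite (mdist_sym b y); lra.
Qed.

Definition unbounded_ultra u := UltraFilter u /\ forall S, bounded_set S -> ~ u S.

Lemma unbounded_asdisjoint u S T :
  unbounded_ultra u -> asdisjoint S T -> u S -> ~ u T.
Proof.
move=> [U bu] ST uS uT; apply: (bu (S `&` T)); last exact: filterI.
by apply: asdisjoint_bounded ST => x [].
Qed.

Lemma unbounded_ultra_exists S : ~ bounded_set S ->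
  exists2 u, unbounded_ultra u & u S.
Proof.
move=> nb; apply: contrapT => nex.
have [||v Uv vS|T bT ST] := @ultra_compact X bounded_set S.
- exact: bounded_set0.
- exact: bounded_setU.
- apply: contrapT => nT; apply: nex; exists v => //; split => // T bT vT.
  by apply: nT; exists T.
- by apply: nb; apply: bounded_setS bT.
Qed.


(* Points of the corona of Y are represented by ultrafilters u containing Y and
   no bounded set; F1 and F2 stand for the families of subsets of Y whose traces
   lie in the two open sides of the trace of E. *)
Definition separator Y u A E :=
  exists F1 F2 : set (set X),
  [/\ forall S1 S2, F1 S1 -> F2 S2 -> asdisjoint S1 S2,
      forall S, S `<=` Y -> asdisjoint S E ->
        exists S1 S2, [/\ F1 S1, F2 S2 & S = S1 `|` S2],
      forall S, F1 S \/ F2 S -> asdisjoint S E,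
      exists2 B, u B & F1 B
    & F2 A].

(** The predicate [P] restricts the separators, so that one notion covers both a fixed dimension
    bound and mere finiteness. *)
Definition locally_separated (P : set X -> Prop) Y u :=
  forall A, A `<=` Y -> (exists2 B, u B & asdisjoint B A) ->
    exists E, [/\ E `<=` Y, separator Y u A E & P E].

(* As for asind_le, cind n Y means dimension at most n - 1. *)
Fixpoint cind (n : nat) Y : Prop :=
  match n with
  | 0 => bounded_set Y
  | k.+1 => forall u, unbounded_ultra u -> u Y -> locally_separated (cind k) Y u
  end.

Lemma locally_separatedS (P Q : set X -> Prop) Y u :
  P `<=` Q -> locally_separated P Y u -> locally_separated Q Y u.
Proof.
by move=> PQ h A AY uA; have [E [? ? /PQ ?]] := h A AY uA; exists E.
Qed.

Lemma cindS n Y : cind n Y -> cind n.+1 Y.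
Proof.
elim: n Y => [|n IH] Y /=; first by move=> bY u [_ ub] /(ub _ bY).
by move=> h u uu uY; apply: locally_separatedS (h u uu uY); exact: IH.
Qed.

Lemma cind_leq n m Y : (n <= m)%N -> cind n Y -> cind m Y.
Proof.
move=> /subnKC <-; elim: (m - n)%N => [|k IH] h; first by rewrite addn0.
by rewrite addnS; apply/cindS/IH.
Qed.

(** Zorn's lemma gives a maximal subset with [r]-separated image under [f]; maximality makes it
    [r]-dense. *)
Lemma separated_net (f : X -> X) (r : R) S : 0 < r ->
  exists E, [/\ E `<=` S,
    forall a b, E a -> E b -> a <> b -> r <= mdist (f a) (f b) &
    forall x, S x -> exists2 e, E e & mdist (f x) (f e) < r].
Proof.
move=> r0.
pose P : set (set X) := [set E | E `<=` S /\
  forall a b, E a -> E b -> a <> b -> r <= mdist (f a) (f b)].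
have [|E [[ES Esep] Emax]] := @Zorn_bigcup X P.
  move=> F FP Ftot; split; first by move=> x [E FE Ex]; exact: (FP _ FE).1.
  move=> a b [E FE Ea] [E' FE' Eb] ab.
  have [EE'|E'E] := Ftot _ _ FE FE'.
    by apply: (FP _ FE').2 => //; exact: EE'.
  by apply: (FP _ FE).2 => //; exact: E'E.
exists E; split => // x Sx; apply: contrapT => nx.
have far e : E e -> r <= mdist (f x) (f e).
  by move=> Ee; rewrite leNgt; apply/negP => lt; apply: nx; exists e.
apply: (Emax (E `|` [set x])).
  split; first by move=> y; left.
  move=> /(_ x (or_intror erefl)) Ex.
  by have := far _ Ex; rewrite mdistxx leNgt r0.
split; first by move=> y [/ES|->].
move=> a b [Ea|->] [Eb|->] ab //; first exact: Esep.
  by rewrite mdist_sym; exact: far.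
exact: far.
Qed.

End Coarse.

(** * Monotonicity of the coarse dimension *)

Section CoarseEmbedding.
Variable X : metric.
Implicit Types (A B S T E Y C D G M : set X) (u v w : set_system X).

Definition coarse_embedding D (j : X -> X) :=
  (forall r : R, exists s : R, forall x y, D x -> D y ->
     mdist x y <= r -> mdist (j x) (j y) <= s) /\
  (forall s : R, exists r : R, forall x y, D x -> D y ->
     mdist (j x) (j y) <= s -> mdist x y <= r).

Lemma coarse_embedding_id D : coarse_embedding D id.
Proof. by split => r; exists r. Qed.

Lemma coarse_bounded D j S : coarse_embedding D j -> S `<=` D ->
  bounded_set S -> bounded_set (j @` S).
Proof.
move=> [hj _] SD [r hr]; have [s hs] := hj r; exists s => _ _ [a Sa <-] [b Sb <-].
by apply: hs; [exact: SD|exact: SD|exact: hr].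
Qed.

Lemma coarse_bounded_inv D j S : coarse_embedding D j -> S `<=` D ->
  bounded_set (j @` S) -> bounded_set S.
Proof.
move=> [_ hj] SD [r hr]; have [s hs] := hj r; exists s => a b Sa Sb.
by apply: hs; [exact: SD|exact: SD|apply: hr; [exists a|exists b]].
Qed.

Lemma coarse_asdisjoint D j A B : coarse_embedding D j -> A `<=` D -> B `<=` D ->
  asdisjoint A B -> asdisjoint (j @` A) (j @` B).
Proof.
move=> hj AD BD h r; have [s hs] := hj.2 r.
apply: bounded_setS (coarse_bounded hj _ (h s)); last by move=> a [/AD].
move=> _ [[a Aa <-] [_ [b Bb <-] ab]]; exists a => //; split => //; exists b => //.
by apply: hs => //; [exact: AD|exact: BD].
Qed.

Lemma coarse_asdisjoint_inv D j A B :
  coarse_embedding D j -> A `<=` D -> B `<=` D ->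
  asdisjoint (j @` A) (j @` B) -> asdisjoint A B.
Proof.
move=> hj AD BD h r; have [s hs] := hj.1 r.
apply: (coarse_bounded_inv hj); first by move=> a [/AD].
apply: bounded_setS (h s) => _ [a [Aa [b Bb ab]] <-]; split; first by exists a.
by exists (j b); [exists b|apply: hs => //; [exact: AD|exact: BD]].
Qed.

(* E is a union of nets of the sets {x in D | d(j x, C) <= k} with larger and
   larger balls removed, the k-th net having mesh 10 (k + 1): then moving j e to
   a point c e of C at distance at most k distorts distances in E by a bounded
   factor, although d(j e, C) may be unbounded on E. *)
Lemma coarse_shadow D C G j :
  coarse_embedding D j -> G `<=` D -> asdisjoint (j @` G) C ->
  exists E c, [/\ E `<=` D, forall e, E e -> C (c e), coarse_embedding E c,
    asdisjoint E G &
    forall S, S `<=` D -> asdisjoint S E -> asdisjoint (j @` S) C].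
Proof.
move=> hj GD GC.
have [[x0 _]|nX] := pselect (exists x : X, True); last first.
  have bd S : bounded_set S by exists 0 => a; case: nX; exists a.
  exists set0, id; split => //; first exact: coarse_embedding_id.
  by move=> S _ _ r; exact: bd.
pose near k x := exists2 c, C c & mdist (j x) c <= k%:R.
(* Points whose images are [k]-close both to [C] and to the image of [G] form a bounded set, since
   these two are asymptotically disjoint; [Rad k] is the radius of a ball containing it. *)
have [Rad RadP] : exists Rad : nat -> R, forall k x, D x -> near k x ->
    (exists2 g, G g & mdist (j x) (j g) <= k%:R) -> mdist x0 x <= Rad k.
  suff h (k : nat) : exists r : R, forall x, D x -> near k x ->
      (exists2 g, G g & mdist (j x) (j g) <= k%:R) -> mdist x0 x <= r.
    by have [f hf] := choice h; exists f.
  pose K := [set x | [/\ D x, near k x &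
    exists2 g, G g & mdist (j x) (j g) <= k%:R]].
  suff /(bounded_set_in_ball x0)[r hr] : bounded_set K.
    by exists r => x Dx nx gx; apply: hr.
  apply: (coarse_bounded_inv hj); first by move=> x [].
  have [s hs] := GC (k%:R + k%:R); exists (k%:R + s + k%:R).
  have H x : K x -> exists g, [/\ mdist (j x) (j g) <= k%:R, (j @` G) (j g) &
      exists2 c, C c & mdist (j g) c <= k%:R + k%:R].
    move=> [Dx [c Cc xc] [g Gg xg]]; exists g; split => //.
    exists c => //; have := mdist_tri (j g) (j x) c.
    rewrite (mdist_sym (j g) (j x)); lra.
  move=> _ _ [x /H[g [xg Gg gc]] <-] [y /H[h [yh Gh hc]] <-].
  have := hs _ _ (conj Gg gc) (conj Gh hc).
  have := mdist_tri3 (j x) (j g) (j h) (j y); rewrite (mdist_sym (j h) (j y)); lra.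
(* Discarding the ball of radius [Rad k] is what keeps [E] away from [G]. *)
pose T k x := [/\ D x, near k x & ~ mdist x0 x <= Rad k].
pose level k x := T k x /\ forall l, (l < k)%N -> ~ T l x.
have level_uniq k l x : level k x -> level l x -> k = l.
  move=> [Tk mk] [Tl ml]; have [lt|lt|//] := ltngtP k l.
    by case: (ml _ lt).
  by case: (mk _ lt).
have level_ex k x : T k x -> exists2 l, (l <= k)%N & level l x.
  move=> Tk; have ex : exists k, `[< T k x >] by exists k; apply/asboolP.
  case: (ex_minnP ex) => l /asboolP Tl lmin; exists l.
    by apply: lmin; apply/asboolP.
  split => // i il /asboolP Ti; have := lmin _ Ti; by rewrite leqNgt il.
pose rho k : R := 10 * k.+1%:R.
have rho0 k : 0 < rho k by rewrite /rho mulr_gt0 // ltr0n.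
have rho_le k l : (k <= l)%N -> rho k <= rho l.
  by move=> kl; rewrite /rho ler_pM2l ?ler_nat ?ltr0n.
have [net netP] := choice (fun p : nat * set X =>
  separated_net j p.2 (rho0 p.1)).
(* The nets are built level by level: candidates at level [k] keep distance [rho k] from everything
   already chosen, so that separation also holds across levels. *)
pose avail (a : set X) k :=
  [set x | level k x /\ forall e, a e -> rho k <= mdist (j x) (j e)].
pose acc := fix acc k := if k is l.+1 then acc l `|` net (l, avail (acc l) l)
  else (set0 : set X).
pose F k := net (k, avail (acc k) k).
have accP k e : acc k e <-> exists2 l, (l < k)%N & F l e.
  elim: k => [|k IH] /=; first by split => // -[].
  split.
    move=> [/IH[l lk Fl]|Fe]; first by exists l => //; exact: ltnW.
    by exists k.
  move=> [l]; rewrite ltnS leq_eqVlt => /orP[/eqP -> Fe|lk Fe]; first by right.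
  by left; apply/IH; exists l.
have Favail k e : F k e -> avail (acc k) k e.
  by have [h _ _] := netP (k, avail (acc k) k); exact: h.
pose E := [set e | exists k, F k e].
have Flevel k e : F k e -> level k e by move=> /Favail[].
have [c cP] : exists c : X -> X, forall x k, level k x ->
    C (c x) /\ mdist (j x) (c x) <= k%:R.
  suff h x : exists c, forall k, level k x -> C c /\ mdist (j x) c <= k%:R.
    by have [f hf] := choice h; exists f.
  have [[k lk]|nl] := pselect (exists k, level k x).
    have [[_ [c Cc xc] _] _] := lk; exists c => l /(level_uniq _ _ _ lk) <-.
    by [].
  by exists x => k lk; case: nl; exists k.
have Fsep k l e e' : (l <= k)%N -> F k e -> F l e' -> e <> e' ->
    rho k <= mdist (j e) (j e').
  rewrite leq_eqVlt => /orP[/eqP ->|lk] Fe Fe' ee'.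
    by have [_ h _] := netP (k, avail (acc k) k); exact: h.
  by have [_] := Favail _ _ Fe; apply; apply/accP; exists l.
(* For distinct [e] and [e'] with [l <= k], the images under [j] are at least [10 (k + 1)] apart,
   while passing to [c e] and [c e'] changes the distance by at most [2 k]; hence the factor 2. *)
have bilip e e' : E e -> E e' -> mdist (c e) (c e') <= 2 * mdist (j e) (j e') /\
    mdist (j e) (j e') <= 2 * mdist (c e) (c e').
  move=> [k Fe] [l Fe'].
  wlog lk : e e' k l Fe Fe' / (l <= k)%N => [H|].
    have [lk|/ltnW kl] := leqP l k; first exact: (H e e' k l).
    by rewrite (mdist_sym (j e)) (mdist_sym (c e)); exact: (H e' e l k).
  have [->|ee'] := pselect (e = e'); first by rewrite !mdistxx; lra.
  have := Fsep _ _ _ _ lk Fe Fe' ee'.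
  have [_ h1] := cP _ _ (Flevel _ _ Fe); have [_ h2] := cP _ _ (Flevel _ _ Fe').
  have : (l%:R : R) <= k%:R by rewrite ler_nat.
  have : (0 : R) <= k%:R by rewrite ler0n.
  rewrite /rho -natr1.
  have := mdist_tri3 (c e) (j e) (j e') (c e').
  have := mdist_tri3 (j e) (c e) (c e') (j e').
  rewrite (mdist_sym (c e) (j e)) (mdist_sym (c e') (j e')).
  lra.
have ED : E `<=` D by move=> e [k /Flevel[[]]].
exists E, c; split => //.
- by move=> e [k /Flevel/cP[]].
- split=> r.
    have [s hs] := hj.1 r; exists (2 * s) => e e' Ee Ee' ee'.
    have [h _] := bilip _ _ Ee Ee'.
    have := hs _ _ (ED _ Ee) (ED _ Ee') ee'; lra.
  have [s hs] := hj.2 (2 * r); exists s => e e' Ee Ee' ee'.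
  apply: hs; [exact: ED|exact: ED|].
  have [_ h] := bilip _ _ Ee Ee'; lra.
(* A point of [E] close to [G] cannot have level [m] or more, as it would lie in a discarded ball;
   at lower levels it lies in the ball of radius [Rad m]. *)
- move=> r; have [s hs] := hj.1 r; have [m hm] := nat_ge s.
  apply: (@bounded_set_ball _ x0 _ (Rad m)) => e [Ee [g Gg eg]].
  have jeg : mdist (j e) (j g) <= m%:R.
    by apply: le_trans hm; apply: hs => //; [exact: ED|exact: GD].
  have [k Fe] := Ee; have [[De [d Cd ed] far] _] := Flevel _ _ Fe.
  have [mk|/ltnW km] := leqP m k.
    case: far; apply: RadP => //; first by exists d.
    by exists g => //; apply: le_trans jeg _; rewrite ler_nat.
  apply: RadP => //; last by exists g.
  by exists d => //; apply: le_trans ed _; rewrite ler_nat.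
(* A point of [S] whose image is [m]-close to [C] lies in the ball of radius [Rad m] or has level at
   most [m], hence is close to [E]. *)
- move=> S SD SE r; have [m hm] := nat_ge r; have [s hs] := hj.2 (rho m).
  have b1 : bounded_set [set x | S x /\ mdist x0 x <= Rad m].
    by apply: (@bounded_set_ball _ x0 _ (Rad m)) => x [].
  apply: bounded_setS (coarse_bounded hj _ (bounded_setU b1 (SE s))); last first.
    by move=> x [[/SD]|[/SD]].
  move=> _ [[x Sx <-] [d Cd xd]]; exists x => //.
  have [le|nle] := pselect (mdist x0 x <= Rad m); first by left.
  right; split => //.
  have [|k km lk] := level_ex m x.
    by split => //; [exact: SD|exists d => //; apply: le_trans hm].
  suff [e Ee xe] : exists2 e, E e & mdist (j x) (j e) < rho k.
    exists e => //; apply: hs; [exact: SD|exact: ED|].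
    by apply: le_trans (ltW xe) _; exact: rho_le.
  have [[e ae xe]|nae] := pselect (exists2 e, acc k e & mdist (j x) (j e) < rho k).
    by exists e => //; have /accP[l _ Fe] := ae; exists l.
  have [_ _ h] := netP (k, avail (acc k) k).
  have [|e Fe xe] := h x; last by exists e => //; exists k.
  split => // e ae; rewrite leNgt; apply/negP => lt; apply: nae; by exists e.
Qed.

Lemma unbounded_push D j u : coarse_embedding D j -> unbounded_ultra u -> u D ->
  unbounded_ultra [set S | u (j @^-1` S)].
Proof.
move=> hj [U bu] uD; split; first exact: ultra_push.
move=> S bS /= uS; apply: (bu (j @^-1` S `&` D)); last exact: filterI.
apply: (coarse_bounded_inv hj); first by move=> x [].
by apply: bounded_setS bS => _ [x [? _] <-].
Qed.

Section Mono.
Variable n : nat.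
Hypothesis cind_coarse_n : forall D M j, coarse_embedding D j ->
  (forall x, D x -> M (j x)) -> cind n M -> cind n D.

(** A separator [C] in [M] is replaced by its shadow [E] in [D], and its two sides are pulled back
    along [j]. The shadow is taken away from [A] and from a member [B] of [u]; it embeds coarsely in
    [C] through [c], so the section hypothesis bounds its dimension. *)
Lemma locally_separated_coarse D M j u : coarse_embedding D j ->
  (forall x, D x -> M (j x)) -> unbounded_ultra u -> u D ->
  locally_separated (cind n) M [set S | u (j @^-1` S)] ->
  locally_separated (cind n) D u.
Proof.
move=> hj DM uu uD locM A AD [B0 uB0 B0A]; have [U _] := uu.
have jAM : j @` A `<=` M by move=> _ [a Aa <-]; exact/DM/AD.
have [|C [CM [F1 [F2 [F12 split12 FC [B1 uB1 F1B1] F2A]]] dC]] := locM _ jAM.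
  exists (j @` (B0 `&` D)).
    have h : u (B0 `&` D) by exact: filterI.
    by rewrite /=; apply: filterS h => x ?; exists x.
  by apply: (coarse_asdisjoint hj) => //; apply: asdisjointSl B0A => x [].
pose B := j @^-1` B1 `&` D.
have uB : u B by exact: filterI.
have BD : B `<=` D by move=> x [].
have [|| E [c [ED EC hc EG Ecov]]] := @coarse_shadow D C (A `|` B) j hj.
- by move=> x [/AD|/BD].
- rewrite image_setU; apply: asdisjointUl; first by apply: FC; right.
  by apply: asdisjointSl (FC B1 (or_introl F1B1)) => _ [x [? _] <-].
exists E; split => //; last exact: (cind_coarse_n hc EC).
have EA : asdisjoint E A by apply: asdisjointSr EG => x; left.
have EB : asdisjoint E B by apply: asdisjointSr EG => x; right.
pose F (F0 : set (set X)) := [set S | [/\ S `<=` D, asdisjoint S E &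
  exists2 S', F0 S' & j @` S `<=` S']].
exists (F F1), (F F2); split.
- move=> S1 S2 [S1D _ [S1' F1S sS1]] [S2D _ [S2' F2S sS2]].
  apply: (coarse_asdisjoint_inv hj) => //.
  exact: asdisjointSS (F12 _ _ F1S F2S).
- move=> S SD SE.
  have [|S1 [S2 [F1S1 F2S2 eS]]] := split12 (j @` S) _ (Ecov _ SD SE).
    by move=> _ [x /SD/DM ? <-].
  exists (S `&` j @^-1` S1), (S `&` j @^-1` S2); split.
  + split; [by move=> x [/SD]|by apply: asdisjointSl SE => x []|].
    by exists S1 => // _ [x [_ ?] <-].
  + split; [by move=> x [/SD]|by apply: asdisjointSl SE => x []|].
    by exists S2 => // _ [x [_ ?] <-].
  + apply/seteqP; split; last by move=> x [] [].
    move=> x Sx; have : (j @` S) (j x) by exists x.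
    by rewrite eS => -[|]; [left|right].
- by move=> S [[]|[]].
- exists B => //; split => //; first exact: asdisjoint_sym.
  by exists B1 => // _ [x [? _] <-].
- by split => //; [exact: asdisjoint_sym|exists (j @` A)].
Qed.

End Mono.

(** Coarse embeddings replace inclusions because the shadow of a separator maps into that separator
    without having to be contained in it; the induction therefore runs over maps. *)
Lemma cind_coarse n D M j : coarse_embedding D j ->
  (forall x, D x -> M (j x)) -> cind n M -> cind n D.
Proof.
elim: n D M j => [|n IH] D M j hj DM.
  move=> /= bM; apply: (coarse_bounded_inv hj) => //.
  by apply: bounded_setS bM => _ [x /DM ? <-].
move=> dM u uu uD; apply: (locally_separated_coarse IH hj DM uu uD).
apply: dM; first exact: (unbounded_push hj uu uD).
by have [U _] := uu; rewrite /=; apply: filterS uD => x; exact: DM.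
Qed.

Lemma cindSS n D M : D `<=` M -> cind n M -> cind n D.
Proof. exact: (cind_coarse (coarse_embedding_id D)). Qed.

Lemma locally_separated_sub n D M u : D `<=` M -> unbounded_ultra u -> u D ->
  locally_separated (cind n) M u -> locally_separated (cind n) D u.
Proof.
by move=> DM; apply: (locally_separated_coarse (@cind_coarse n)
  (coarse_embedding_id D) DM).
Qed.

End CoarseEmbedding.

(** * Boundedness of the dimension *)

Section Bound.
Variable X : metric.
Implicit Types (A B S T E Y N P Q : set X) (u v w : set_system X).

(** The corona point represented by [u] lies outside the trace of [S]. *)
Definition away u S := exists2 B, u B & asdisjoint B S.

(** Distinct ultrafilters can represent the same corona point; this relation identifies them. *)
Definition same_end u v := forall S T, u S -> v T -> ~ asdisjoint S T.

Lemma awayS u S T : S `<=` T -> away u T -> away u S.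
Proof. by move=> ST [B uB BT]; exists B => //; apply: asdisjointSr BT. Qed.

Lemma awayU u S T : UltraFilter u -> away u S -> away u T -> away u (S `|` T).
Proof.
move=> U [B uB BS] [C uC CT]; exists (B `&` C); first exact: filterI.
by apply: asdisjointUr; [apply: asdisjointSl BS|apply: asdisjointSl CT] => x [].
Qed.

Lemma away_mem u Y S : unbounded_ultra u -> u Y -> away u (Y `\` S) -> u S.
Proof.
move=> uu uY [B uB BYS]; have [U _] := uu; apply: contrapT => /(ultraC U) uS.
apply: (unbounded_asdisjoint uu BYS uB).
by rewrite setDE; exact: filterI.
Qed.

Lemma same_endPn u v : ~ same_end u v ->
  exists S T, [/\ u S, v T & asdisjoint S T].
Proof.
move=> h; apply: contrapT => nex; apply: h => S T uS vT ST; apply: nex.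
by exists S, T.
Qed.

Lemma same_end_trans u v w : UltraFilter v ->
  same_end u v -> same_end v w -> same_end u w.
Proof.
move=> V uv vw S T uS wT ST; have [Z [_ SZ ZT]] := asdisjoint_interp ST.
by case: (in_ultra_setVsetC Z V) => [vZ|vZ]; [apply: vw ZT|apply: uv SZ].
Qed.

Lemma asdisjoint_bigcup_lt B (W : nat -> set X) m :
  (forall k, (k < m)%N -> asdisjoint B (W k)) ->
  asdisjoint B [set x | exists2 k, (k < m)%N & W k x].
Proof.
elim: m => [|m IH] h.
  by apply: asdisjointSr (asdisjoint0r B) => x [].
apply: (@asdisjointSr _ _ ([set x | exists2 k, (k < m)%N & W k x] `|` W m)).
  move=> x [k]; rewrite ltnS leq_eqVlt => /orP[/eqP ->|km] Wx; first by right.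
  by left; exists k.
by apply: asdisjointUr; [apply: IH => k km; apply: h; exact: ltnW|exact: h].
Qed.

(** This is what the transfinite induction provides: separators of finite dimension, with no common
    bound required. *)
Definition finitely_separated Y := forall u, unbounded_ultra u -> u Y ->
  locally_separated (fun E => exists n, cind n E) Y u.

(* Let w be a limit of the ultrafilters v k. A separator E of finite dimension
   n between w and the complement of the union of the N k has w, hence v k for
   some k >= n, on its near side, and then E `&` N k separates v k from A k. *)
Lemma no_bad_sequence Y (v : nat -> set_system X) (N P A : nat -> set X) :
  finitely_separated Y ->
  (forall k, unbounded_ultra (v k)) -> (forall k, v k Y) ->
  (forall k, v k (P k)) -> (forall k, P k `<=` Y) ->
  (forall k, asdisjoint (P k) (Y `\` N k)) ->
  (forall k, asdisjoint (N k) (A k)) ->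
  (forall j k, (j < k)%N -> asdisjoint (N j) (N k)) ->
  (forall k, A k `<=` Y) -> (forall k, N k `<=` Y) ->
  (forall k E, E `<=` Y -> separator Y (v k) (A k) E -> ~ cind k E) ->
  False.
Proof.
move=> finY vu vY vP PY PN NA NN AY NY bad.
have U k : UltraFilter (v k) by case: (vu k).
(* [K k] is the bounded part of [N k] within [k] of the earlier [N j]. Removing it makes [N' k]
   asymptotically disjoint from the union of all the other [N' j], which pairwise disjointness alone
   does not give. *)
pose K k := [set b | N k b /\
  exists2 a, (exists2 j, (j < k)%N & N j a) & mdist b a <= k%:R].
have bK k : bounded_set (K k).
  by apply: asdisjoint_bigcup_lt => j jk; apply/asdisjoint_sym/NN.
pose N' k := N k `\` K k.
have N'N k : N' k `<=` N k by move=> x [].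
have PN' k : asdisjoint (P k) (Y `\` N' k).
  apply: (@asdisjointSr _ _ ((Y `\` N k) `|` K k)).
    move=> x [Yx nN']; have [Nx|nNx] := pselect (N k x); last by left.
    by right; apply: contrapT => nK; apply: nN'.
  by apply: asdisjointUr => //; exact: bounded_asdisjointr.
have vN' k : v k (N' k) by apply: (@away_mem _ Y) => //; exists (P k).
have N'far k : asdisjoint (N' k) [set x | exists2 j, j <> k & N' j x].
  move=> r; have [m rm] := nat_ge r.
  have h : asdisjoint (N' k) [set x | exists2 j, (j < m + k)%N &
      (j <> k /\ N' j x)].
    apply: asdisjoint_bigcup_lt => j _.
    have [->|jk] := pselect (j = k).
      by apply: asdisjointSr (asdisjoint0r _) => x [].
    apply: (@asdisjointSS _ (N k) _ (N j)); first exact: N'N.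
      by move=> x [_ /N'N].
    move/eqP: jk; rewrite neq_ltn => /orP[jk|jk]; last exact: NN.
    by apply/asdisjoint_sym/NN.
  apply: bounded_setS (h r) => a [Na [b [j jk Nb] ab]]; split => //.
  exists b => //; exists j => //; rewrite ltnNge; apply/negP => mkj.
  have kj : (k < j)%N by move: mkj; move/eqP: jk; lia.
  case: Nb => Nb; apply; split => //; exists a.
    by exists k => //; exact: N'N.
  rewrite mdist_sym; apply: (le_trans ab); apply: (le_trans rm).
  by rewrite ler_nat; move: mkj; lia.
pose A0 := Y `\` [set x | exists k, N' k x].
have A0N k : A0 `<=` Y `\` N' k.
  by move=> x [Yx nx]; split => // Nx; apply: nx; exists k.
(* Points within [k] of the part of [Y] outside [N' k] are dropped, so that the union [P0] stays
   asymptotically disjoint from [A0]. *)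
pose P' k := P k `\`
  [set p | P k p /\ exists2 y, (Y `\` N' k) y & mdist p y <= k%:R].
have vP' k : v k (P' k).
  rewrite /P' setDE; apply: filterI => //; apply: ultraC => //.
  by apply: (vu k).2; exact: PN'.
pose P0 := [set x | exists k, P' k x].
have P0A0 : asdisjoint P0 A0.
  move=> r; have [m rm] := nat_ge r.
  have h : asdisjoint A0 [set x | exists2 k, (k < m)%N & P' k x].
    apply: asdisjoint_bigcup_lt => k _; apply: asdisjoint_sym.
    by apply: asdisjointSS (PN' k) => //; move=> x [].
  apply: bounded_setS (asdisjoint_sym h r) => p [[k Pp] [y Ay py]].
  split; last by exists y.
  exists k => //; rewrite ltnNge; apply/negP => mk.
  case: Pp => Pp; apply; split => //; exists y; first exact: A0N.
  by apply: (le_trans py); apply: (le_trans rm); rewrite ler_nat.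
(* Sets belonging to [v k] for all large [k]; an ultrafilter [w] containing them represents a limit
   of the [v k]. *)
pose G : set_system X := [set S | exists m, forall k, (m <= k)%N -> v k S].
have PG : ProperFilter G.
  split; first by move=> [m /(_ m (leqnn m))]; exact: filter_not_empty.
  split; first by exists 0%N => k _; exact: filterT.
    move=> S T [m hS] [l hT]; exists (m + l)%N => k mlk.
    by apply: filterI; [apply: hS|apply: hT]; move: mlk; lia.
  by move=> S T ST [m hS]; exists m => k /hS; apply: filterS.
have [w [W Gw]] := ultraFilterLemma PG.
have uw : unbounded_ultra w.
  split => // S bS wS.
  have wnS : w (~` S).
    by apply: Gw; exists 0%N => k _; apply: ultraC => //; exact: (vu k).2.
  have : w (S `&` ~` S) by exact: filterI.
  by rewrite setICr; exact: filter_not_empty.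
have wY : w Y by apply: Gw; exists 0%N.
have [||E [EY [F1 [F2 [F12 split12 FE [B wB F1B] F2A]]] [n dE]]] :=
  finY w uw wY A0; first by move=> x [].
  exists P0 => //; apply: Gw; exists 0%N => k _.
  by apply: filterS (vP' k) => x ?; exists k.
have [k nk vB] : exists2 k, (n <= k)%N & v k B.
  apply: contrapT => nex.
  have wnB : w (~` B).
    apply: Gw; exists n => k nk; apply: ultraC => // vB; apply: nex.
    by exists k.
  have : w (B `&` ~` B) by exact: filterI.
  by rewrite setICr; exact: filter_not_empty.
pose E' := E `&` N' k.
apply: (bad k E'); first by move=> x [/EY].
  2: by apply: (cind_leq nk); apply: cindSS dE => x [].
pose H := Y `\` N' k.
(* Outside [N' k] there are only [A0], on the far side of [E], and the other [N' j], which are far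
   from [N' k]. *)
have F1H S : F1 S -> asdisjoint (S `&` N' k) H.
  move=> F1S; apply: (@asdisjointSr _ _ (A0 `|` [set x | exists2 j, j <> k & N' j x])).
    move=> x [Yx nNx]; have [[j Nj]|nN] := pselect (exists j, N' j x); last by left.
    by right; exists j => // jk; apply: nNx; rewrite -jk.
  apply: asdisjointUr; last by apply: asdisjointSl (N'far k) => x [].
  by apply: asdisjointSl (F12 _ _ F1S F2A) => x [].
pose G1 := [set S | exists2 S0, F1 S0 & S = S0 `&` N' k].
(* The far side takes every set compatible with [E'] and the near side, so that it can absorb
   whatever lies outside [N' k]. *)
pose G2 := [set S | asdisjoint S E' /\ forall S1, G1 S1 -> asdisjoint S1 S].
exists G1, G2; split.
- by move=> S1 S2 G1S1 [_]; exact.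
- move=> S SY SE'.
  have SNE : asdisjoint (S `&` N' k) E.
    apply: (@asdisjointSr _ _ (E' `|` ((E `&` A0) `|` [set x | exists2 j, j <> k & N' j x]))).
      move=> x Ex; have [Nx|nNx] := pselect (N' k x); first by left.
      right; have [[j Nj]|nN] := pselect (exists j, N' j x).
        by right; exists j => // jk; apply: nNx; rewrite -jk.
      by left; split => //; split => //; exact: EY.
    apply: asdisjointUr; first by apply: asdisjointSl SE' => x [].
    apply: asdisjointUr; last by apply: asdisjointSl (N'far k) => x [].
    apply: bounded_asdisjointr.
    by apply: asdisjoint_bounded (FE A0 (or_intror F2A)) => x [].
  have [|S1 [S2 [F1S1 F2S2 eS]]] := split12 _ _ SNE; first by move=> x [/SY].
  exists S1, (S2 `|` (S `&` H)); split.
  + exists S1 => //; apply/seteqP; split => [x S1x|x []//]; split => //.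
    by have [_] : (S `&` N' k) x by rewrite eS; left.
  + split.
      apply: asdisjointUl; last by apply: asdisjointSl SE' => x [].
      apply: asdisjointSl SE' => x S2x.
      by have [] : (S `&` N' k) x by rewrite eS; right.
    move=> _ [S0 F1S0 ->]; apply: asdisjointUr.
      by apply: asdisjointSl (F12 _ _ F1S0 F2S2) => x [].
    by apply: asdisjointSr (F1H _ F1S0) => x [].
  + rewrite setUA -eS; apply/seteqP; split; last by move=> x [] [].
    move=> x Sx; have [Nx|nNx] := pselect (N' k x); first by left.
    by right; split => //; split => //; exact: SY.
- move=> S [[S0 F1S0 ->]|[]//].
  by apply: asdisjointSS (FE S0 (or_introl F1S0)) => x [].
- by exists (B `&` N' k); [exact: filterI|exists B].
- split; first by apply/asdisjoint_sym/(asdisjointSl _ (NA k)) => x [_ /N'N].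
  by move=> _ [S0 _ ->]; apply: asdisjointSl (NA k) => x [_ /N'N].
Qed.

Lemma locally_separatedPn (F : set X -> Prop) Y u : ~ locally_separated F Y u ->
  exists A, [/\ A `<=` Y, away u A &
    forall E, E `<=` Y -> separator Y u A E -> ~ F E].
Proof.
move=> h; apply: contrapT => nex; apply: h => A AY uA.
apply: contrapT => nE; apply: nex; exists A; split => // E EY sE FE.
by apply: nE; exists E.
Qed.

(** Otherwise every neighbourhood of [u] contains, for each [k], a point [v] other than [u] where
    separation in dimension [k] fails. Shrinking the neighbourhoods of [u] past the sets [N] already
    chosen yields the sequence excluded by [no_bad_sequence]. *)
Lemma cind_bounded_near Y u : finitely_separated Y -> unbounded_ultra u -> u Y ->
  exists S n, away u (Y `\` S) /\ forall v, unbounded_ultra v -> v S -> v Y ->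
    same_end v u \/ locally_separated (cind n) Y v.
Proof.
move=> finY uu uY; apply: contrapT => nex; have [U _] := uu.
(* [good] records a bad point [v], its neighbourhood [N] inside [S], a member [P] of [v] deep inside
   [N], a set [A] hard to separate from [v], and a smaller neighbourhood [S'] of [u] avoiding
   [N]. *)
pose good k S (p : set_system X * set X * set X * set X * set X) :=
  let: (v, N, P, A, S') := p in
  [/\ unbounded_ultra v, v Y, v P & P `<=` Y] /\
  [/\ asdisjoint P (Y `\` N), asdisjoint N A, A `<=` Y & N `<=` Y] /\
  [/\ N `<=` S, S' `<=` S, away u (Y `\` S') & asdisjoint N S'] /\
  (forall E, E `<=` Y -> separator Y v A E -> ~ cind k E).
have step (q : nat * set X) : exists p, away u (Y `\` q.2) -> good q.1 q.2 p.
  case: q => k S /=.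
  have [awS|nS] := pselect (away u (Y `\` S)); last first.
    (* A placeholder: nothing is claimed when [S] is not a neighbourhood of [u]. *)
    by exists (setT, set0, set0, set0, set0).
  have [B uB BS] := awS; have [T [BT BnT TS]] := asdisjoint_interp BS.
  have [v [uv vT vY nvu nlv]] : exists v, [/\ unbounded_ultra v, v T, v Y,
      ~ same_end v u & ~ locally_separated (cind k) Y v].
    apply: contrapT => nv; apply: nex; exists T, k; split.
      by exists B => //; apply: asdisjointSr BnT => x [].
    move=> v uv vT vY; apply: contrapT => /not_orP[? ?].
    by apply: nv; exists v.
  have [V _] := uv.
  have [A [AY [P0 vP0 P0A] Abad]] := locally_separatedPn nlv.
  have [S1 [Q [vS1 uQ S1Q]]] := same_endPn nvu.
  pose P := (P0 `&` T) `&` (S1 `&` Y).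
  have vP : v P by apply: filterI; exact: filterI.
  have PG : asdisjoint P ((Y `\` S) `|` (A `|` Q)).
    apply: asdisjointUr; first by apply: asdisjointSl TS => x [[]].
    apply: asdisjointUr; first by apply: asdisjointSl P0A => x [[]].
    by apply: asdisjointSl S1Q => x [_ []].
  have [T2 [PT2 PnT2 T2G]] := asdisjoint_interp PG.
  pose N := (T2 `&` S) `&` Y.
  have QN : asdisjoint Q N.
    by apply: asdisjoint_sym; apply: asdisjointSS T2G => x; [case=> -[]|right; right].
  (* [Q] belongs to [u] and is away from [N]; its enlargement [T3], still away from [N], cuts out
     the next neighbourhood of [u]. *)
  have [T3 [QT3 QnT3 T3N]] := asdisjoint_interp QN.
  exists (v, N, P, A, S `&` T3) => _; split; first by split => // x [_ []].
  split; [split => //|split => //; split].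
  - apply: (@asdisjointSr _ _ (~` T2 `|` (Y `\` S))).
      move=> x [Yx nN]; have [Tx|nTx] := pselect (T2 x); last by left.
      by right; split => // Sx; apply: nN.
    by apply: asdisjointUr => //; apply: asdisjointSr PG => x; left.
  - by apply: asdisjointSS T2G => x; [case=> -[]|right; left].
  - by move=> x [].
  - by move=> x [[]].
  - by move=> x [].
  - apply: (@awayS _ _ ((Y `\` S) `|` ~` T3)).
      move=> x [Yx nS]; have [Sx|nSx] := pselect (S x); last by left.
      by right=> Tx; apply: nS.
    by apply: awayU => //; exists Q.
  - by apply: asdisjoint_sym; apply: asdisjointSl T3N => x [].
have [f fP] := choice step.
pose s := fix s k := if k is l.+1 then (f (l, s l)).2 else Y.
have sP k : away u (Y `\` s k) /\ good k (s k) (f (k, s k)).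
  elim: k => [|k [ak gk]].
    suff h : away u (Y `\` s 0%N) by split => //; exact: (fP (0%N, _)).
    by exists setT; [exact: filterT|rewrite setDv; exact: asdisjoint0r].
  suff h : away u (Y `\` s k.+1) by split => //; exact: (fP (k.+1, _)).
  by move: gk => /=; case: (f _) => -[[[v N] P] A] S' [_ [_ [[]]]].
have sS j k : (j <= k)%N -> s k `<=` s j.
  move=> /subnKC <-; elim: (k - j)%N => [|m IH]; first by rewrite addn0.
  rewrite addnS; apply: subset_trans IH; have [_] := sP (j + m)%N.
  by rewrite /=; case: (f _) => -[[[v N] P] A] S' [_ [_ [[]]]].
pose v k := (f (k, s k)).1.1.1.1; pose N k := (f (k, s k)).1.1.1.2.
pose P k := (f (k, s k)).1.1.2; pose A k := (f (k, s k)).1.2.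
have H k : good k (s k) (v k, N k, P k, A k, s k.+1).
  have [_] := sP k.
  by rewrite /v /N /P /A /=; case: (f _) => -[[[? ?] ?] ?] ?.
apply: (@no_bad_sequence Y v N P A) => // k; have := H k.
- by move=> [[]].
- by move=> [[]].
- by move=> [[]].
- by move=> [[]].
- by move=> [_ [[]]].
- by move=> [_ [[]]].
- move=> [_ [_ [[_ _ _ NS] _]]] l kl.
  apply: asdisjointSr NS; apply: subset_trans (sS _ _ kl).
  by have [_ [_ [[]]]] := H l.
- by move=> [_ [[]]].
- by move=> [_ [[]]].
- by move=> [_ [_ [_]]].
Qed.

(* By compactness the previous lemma bounds the local dimension by n outside
   finitely many points. Every point is surrounded by thick shells E that avoid
   all of these, so that cind n.+1 E holds. *)
Lemma cind_bounded Y : finitely_separated Y -> exists n, cind n Y.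
Proof.
move=> finY.
(* The finite exceptional set is encoded by what is used of it: each [v] is away from some [Q] to
   which all exceptional points in [T] other than [v] adhere. In this form the condition passes to
   unions. *)
pose F T := exists n, forall v, unbounded_ultra v -> exists Q, away v Q /\
  forall w, unbounded_ultra w -> w T -> w Y ->
    [\/ same_end w v, ~ away w Q | locally_separated (cind n) Y w].
have leloc n m u : (n <= m)%N ->
    locally_separated (cind n) Y u -> locally_separated (cind m) Y u.
  by move=> nm; apply: locally_separatedS => E; exact: cind_leq.
have away0 v : UltraFilter v -> away v set0.
  by move=> V; exists setT; [exact: filterT|exact: asdisjoint0r].
have [|||T [n FT] YT] := @ultra_compact X F Y.
- exists 0%N => v [V _]; exists set0; split; first exact: away0.
  by move=> w [W _] w0; case: (@filter_not_empty _ w _).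
- move=> S T [n hn] [m hm]; exists (maxn n m) => v vu; have [V _] := vu.
  have [Q [vQ hQ]] := hn v vu; have [Q' [vQ' hQ']] := hm v vu.
  exists (Q `|` Q'); split; first exact: awayU.
  move=> w wu wST wY; have [W _] := wu.
  have [wS|wT] := ultraU W wST.
    have [?|h|h] := hQ w wu wS wY; [exact: Or31|apply: Or32|apply: Or33].
      by move=> hU; apply: h; apply: awayS hU => x; left.
    by apply: leloc h; exact: leq_maxl.
  have [?|h|h] := hQ' w wu wT wY; [exact: Or31|apply: Or32|apply: Or33].
    by move=> hU; apply: h; apply: awayS hU => x; right.
  by apply: leloc h; exact: leq_maxr.
- move=> u U uY.
  have [uu|nu] := pselect (unbounded_ultra u); last first.
    have [T bT uT] : exists2 T, bounded_set T & u T.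
      apply: contrapT => nT; apply: nu; split => // S bS uS; apply: nT.
      by exists S.
    exists T => //; exists 0%N => v [V _]; exists set0; split; first exact: away0.
    by move=> w [_ /(_ T bT)].
  have [S [n [uS hS]]] := cind_bounded_near finY uu uY.
  exists S; last exact: (away_mem uu uY uS).
  exists n => v vu; have [V _] := vu.
  have [uv|/same_endPn[S1 [Q [uS1 vQ S1Q]]]] := pselect (same_end u v).
    exists set0; split; first exact: away0.
    move=> w wu wS wY; have [wu'|h] := hS w wu wS wY; last exact: Or33.
    by apply: Or31; apply: same_end_trans uv.
  exists S1; split; first by exists Q => //; exact: asdisjoint_sym.
  move=> w wu wS wY; have [wu'|h] := hS w wu wS wY; last exact: Or33.
  by apply: Or32 => -[B wB /wu']; exact.
(* The local bound is [cind n] for separators inside a shell, so the shell satisfies [cind n.+1] and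
   [Y] satisfies [cind n.+2]. *)
exists n.+2 => u uu uY A AY uA; have [U _] := uu.
have [Q [uQ hQ]] := FT u uu.
have [B0 uB0 B0AQ] := awayU U uA uQ; pose B := B0 `&` Y.
have uB : u B by exact: filterI.
have BAQ : asdisjoint B (A `|` Q) by apply: asdisjointSl B0AQ => x [].
have [T1 [BT1 BnT1 T1AQ]] := asdisjoint_interp BAQ.
have [T2 [T12 T1nT2 T2AQ]] := asdisjoint_interp T1AQ.
(* The shell between two nested neighbourhoods of [B]: it is away from [B], hence misses [u], and
   away from [Q], hence misses the other exceptional points. *)
pose E := (T2 `\` T1) `&` Y.
have EY : E `<=` Y by move=> x [].
have EAQ : asdisjoint E (A `|` Q) by apply: asdisjointSl T2AQ => x [[]].
have BE : asdisjoint B E by apply: asdisjointSr BnT1 => x [[]].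
exists E; split => //.
  exists [set S | [/\ S `<=` Y, asdisjoint S E & asdisjoint S (~` T2)]],
    [set S | [/\ S `<=` Y, asdisjoint S E & asdisjoint S T1]]; split.
  - move=> S1 S2 [S1Y S1E S1T] [S2Y S2E S2T].
    apply: (@asdisjointSr _ _ ((S2 `&` T1) `|` ((S2 `&` E) `|` ~` T2))).
      move=> x S2x; have [T1x|nT1] := pselect (T1 x); first by left.
      right; have [T2x|nT2] := pselect (T2 x); last by right.
      by left; split => //; split => //; exact: S2Y.
    apply: asdisjointUr; [|apply: asdisjointUr => //];
      apply: bounded_asdisjointr.
      by apply: asdisjoint_bounded S2T => x [].
    by apply: asdisjoint_bounded S2E => x [].
  - move=> S SY SE; exists (S `&` T1), (S `\` T1); split.
    + split; [by move=> x [/SY]|by apply: asdisjointSl SE => x []|].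
      by apply: asdisjointSl T1nT2 => x [].
    + split; [by move=> x [/SY]|by apply: asdisjointSl SE => x []|].
      apply: (@asdisjointSl _ ((S `&` E) `|` ~` T2)).
        move=> x [Sx nT1]; have [T2x|nT2] := pselect (T2 x); last by right.
        by left; split => //; split => //; exact: SY.
      apply: asdisjointUl; last exact: asdisjoint_sym.
      by apply/bounded_asdisjointl/(asdisjoint_bounded _ _ SE) => x [].
    + by rewrite setUIDK.
  - by move=> S [[]|[]].
  - exists B => //; split => //; first by move=> x [].
    by apply: asdisjointSr BnT1 => x nT2 T1x; apply: nT2; exact: T12.
  - split => //; apply: asdisjoint_sym; first by apply: asdisjointSr EAQ => x; left.
    by apply: asdisjointSr T1AQ => x; left.
move=> w wu wE; have [W _] := wu.
have wY : w Y by apply: filterS wE.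
have wT : w T by apply: filterS wY.
apply: (locally_separated_sub EY wu wE).
have [wu'|h|//] := hQ w wu wT wY.
  by case: (wu' E B wE uB (asdisjoint_sym BE)).
by case: h; exists E => //; apply: asdisjointSr EAQ => x; right.
Qed.

End Bound.

(** * Ultrafilters and the Higson corona *)

Section Dictionary.
Variable M : metric.
Implicit Types (A B C S T K : set M) (v w : set_system M) (p q : hspace M).

Definition higson_lim v p := forall (phi : Ch M) (e : R), 0 < e ->
  v [set m | `|sval phi m - p phi| < e].

Lemma higson_lim_nbhs v p (W : set (hspace M)) : UltraFilter v ->
  higson_lim v p -> nbhs p W -> v (@hemb M @^-1` W).
Proof.
move=> V vp pW.
suff cv : (@hemb M @ v --> p) by exact: (cv _ pW).
apply/cvg_sup => phi U [G [[H oH <-] Hp GU]].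
have : nbhs (p phi) H by exact: open_nbhs_nbhs.
move=> /nbhs_ballP[e /= e0 pe].
have := vp phi e e0; rewrite nbhs_simpl /=; apply: filterS => m me.
by apply: GU; apply: pe; rewrite /ball /= distrC.
Qed.

Lemma higson_lim_closure v p A : UltraFilter v -> higson_lim v p -> v A ->
  closure (@hemb M @` A) p.
Proof.
move=> V vp vA W pW.
have : v (@hemb M @^-1` W `&` A).
  by apply: filterI => //; exact: (higson_lim_nbhs V vp pW).
by move=> /filter_ex[m [Wm Am]]; exists (hemb m); split => //; exists m.
Qed.

Lemma nbhs_hspace p (phi : Ch M) (e : R) : 0 < e ->
  nbhs p [set q : hspace M | `|q phi - p phi| < e].
Proof.
move=> e0.
have /cvg_sup/(_ phi) : nbhs p --> p by [].
apply; exists [set q : hspace M | (ball (p phi) e)° (q phi)]; split.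
- by exists (ball (p phi) e)° => //; exact: open_interior.
- exact: nbhsx_ballx.
- by move=> q /interior_subset; rewrite /ball /= distrC.
Qed.

Lemma closure_higson_lim p A : closure (@hemb M @` A) p ->
  exists v, [/\ UltraFilter v, v A & higson_lim v p].
Proof.
move=> clp.
pose G : set_system M := [set S | exists2 W, nbhs p W & A `&` @hemb M @^-1` W `<=` S].
have PG : ProperFilter G.
  split.
    by move=> [W /clp[_ [[m Am <-] Wm]] sub]; apply: (sub m).
  split; first by exists setT => //; exact: filterT.
    move=> S T [W pW sS] [W' pW' sT]; exists (W `&` W'); first exact: filterI.
    by move=> m [Am [Wm Wm']]; split; [apply: sS|apply: sT].
  by move=> S T ST [W pW sS]; exists W => //; apply: subset_trans ST.
have [v [V Gv]] := ultraFilterLemma PG; exists v; split => //.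
  by apply: Gv; exists setT; [exact: filterT|move=> m []].
move=> phi e e0; apply: Gv.
exists [set q : hspace M | `|q phi - p phi| < e]; first exact: nbhs_hspace.
by move=> m [].
Qed.

(** Each coordinate pushes [v] to an ultrafilter on the compact unit interval, which converges
    there. *)
Lemma higson_lim_exists v : UltraFilter v -> exists p, higson_lim v p.
Proof.
move=> V.
have h (phi : Ch M) : exists t : R, forall e, 0 < e ->
    v [set m | `|sval phi m - t| < e].
  have : compact `[0 : R, 1] by exact: segment_compact.
  rewrite compact_ultra => /(_ _ (ultra_push (sval phi) V)) [].
    rewrite /=; apply: (@filterS _ v _ setT); last exact: filterT.
    by move=> m _ /=; rewrite in_itv /=; case: (svalP phi) => _ + _; apply.
  move=> t [_ vt]; exists t => e e0; have vb : v (sval phi @^-1` ball t e).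
    exact: (vt _ (nbhsx_ballx t _ e0)).
  by apply: filterS vb => m; rewrite /ball /= distrC.
by have [p hp] := choice h; exists p.
Qed.

(** * Distance functions and a slowly oscillating Urysohn function *)

Definition setdist A (x : M) : R := inf [set mdist x a | a in A].

Lemma setdist_has_inf A x : A !=set0 -> has_inf [set mdist x a | a in A].
Proof.
move=> [a Aa]; split; first by exists (mdist x a), a.
by exists 0 => _ [b _ <-]; exact: mdist_ge0.
Qed.

Lemma setdist_ge0 A x : A !=set0 -> 0 <= setdist A x.
Proof.
move=> A0; apply: lb_le_inf; first by have [] := setdist_has_inf x A0.
by move=> _ [b _ <-]; exact: mdist_ge0.
Qed.

Lemma setdist_le A x a : A a -> setdist A x <= mdist x a.
Proof.
move=> Aa; apply: ge_inf; last by exists a.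
by have [] := setdist_has_inf x (ex_intro _ a Aa : A !=set0).
Qed.

Lemma setdist_approx A x (e : R) : A !=set0 -> 0 < e ->
  exists2 a, A a & mdist x a < setdist A x + e.
Proof.
move=> A0 e0; have [_ [a Aa <-] lt] := inf_adherent e0 (setdist_has_inf x A0).
by exists a.
Qed.

Lemma setdist_mem A x : A x -> setdist A x = 0.
Proof.
move=> Ax; apply/eqP; rewrite eq_le setdist_ge0; last by exists x.
by rewrite andbT -(mdistxx x) setdist_le.
Qed.

Lemma setdist_lip A x y : A !=set0 -> setdist A x - setdist A y <= mdist x y.
Proof.
move=> A0; apply/ler_addgt0Pr => e e0; have [a Aa lt] := setdist_approx y A0 e0.
have := setdist_le x Aa; have := mdist_tri x y a; lra.
Qed.

Lemma setdist_normlip A x y : A !=set0 -> `|setdist A x - setdist A y| <= mdist x y.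
Proof.
move=> A0; rewrite ler_norml; have := setdist_lip x y A0.
have := setdist_lip y x A0; rewrite (mdist_sym y x) => h1 h2.
apply/andP; split; lra.
Qed.

(** Over the common denominator the numerator is [(a - a') b' - a' (b - b')], at most [d (a' + b')]
    in absolute value, and the factor [a' + b'] cancels. *)
Lemma ratio_lip (a b a' b' d : R) : 0 <= a -> 0 <= b -> 0 <= a' -> 0 <= b' ->
  0 < a + b -> 0 < a' + b' -> `|a - a'| <= d -> `|b - b'| <= d ->
  `|a / (a + b) - a' / (a' + b')| <= d / (a + b).
Proof.
move=> a0 b0 a'0 b'0 s s' ha hb.
have -> : a / (a + b) - a' / (a' + b') =
    ((a - a') * b' - a' * (b - b')) / ((a + b) * (a' + b')).
  by field; apply/andP; split; rewrite gt_eqF.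
rewrite normrM normfV (gtr0_norm (mulr_gt0 s s')) invfM mulrA.
rewrite mulrAC ler_pM2r ?invr_gt0 // ler_pdivrMr //.
apply: le_trans (ler_normB _ _) _; rewrite !normrM (ger0_norm b'0) (ger0_norm a'0).
rewrite mulrDr addrC lerD //; first by rewrite mulrC ler_wpM2r.
by rewrite ler_wpM2r.
Qed.

(* Urysohn's lemma: the quotient d(x,A) / (d(x,A) + d(x,B)) is slowly
   oscillating because d(x,A) + d(x,B) tends to infinity. *)
Lemma asdisjoint_lim v p A B : unbounded_ultra v -> higson_lim v p -> v B ->
  asdisjoint B A -> ~ closure (@hemb M @` A) p.
Proof.
move=> vu vp vB BA clp; have [V _] := vu.
have A0 : A !=set0.
  by have [_ [[a Aa _] _]] := clp setT filterT; exists a.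
(* Removing the bounded part of [B] within 1 of [A] keeps the denominator [s] at least 1. *)
pose B' := B `\` [set b | B b /\ exists2 a, A a & mdist b a <= 1].
have vB' : v B'.
  by rewrite /B' setDE; apply: filterI => //; apply: (ultraC V); apply: vu.2; exact: BA.
have B'0 : B' !=set0 by exact: filter_ex vB'.
have B'A a b : A a -> B' b -> 1 < mdist b a.
  move=> Aa [Bb nb]; rewrite ltNge; apply/negP => le; apply: nb; split => //.
  by exists a.
pose s x := setdist A x + setdist B' x.
have s1 x : 1 <= s x.
  apply/ler_addgt0Pr => e e0; have e2 : 0 < e / 2 by lra.
  have [a Aa xa] := setdist_approx x A0 e2; have [b Bb xb] := setdist_approx x B'0 e2.
  have := B'A _ _ Aa Bb; have := mdist_tri b x a; rewrite (mdist_sym b x) /s; lra.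
have s0 x : 0 < s x by have := s1 x; lra.
pose f x := setdist A x / s x.
have flip x y : `|f x - f y| <= mdist x y / s x.
  by apply: ratio_lip; [exact: setdist_ge0|exact: setdist_ge0|exact: setdist_ge0|
    exact: setdist_ge0|exact: s0|exact: s0|exact: setdist_normlip|exact: setdist_normlip].
have hf : is_higson_fun f.
  split.
  - move=> x e e0; exists e => // y xy; apply: le_lt_trans (flip x y) _.
    apply: le_lt_trans xy; rewrite ler_pdivrMr // ler_peMr //; exact: mdist_ge0.
  - move=> x; rewrite /f divr_ge0 ?setdist_ge0 ?(ltW (s0 x)) //=.
    by rewrite ler_pdivrMr // mul1r /s lerDl setdist_ge0.
  - move=> x0 r e r0 e0; pose k := 2 * r / e.
    have [rho hrho] := bounded_set_in_ball x0 (BA (2 * k + 2)).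
    exists (rho + k + 2) => x xx0 y z xy xz.
    have sk : k < s x.
      rewrite ltNge; apply/negP => sk.
      have [a Aa xa] := setdist_approx x A0 (@ltr01 R).
      have [b Bb xb] := setdist_approx x B'0 (@ltr01 R).
      have sA := setdist_ge0 x A0; have sB := setdist_ge0 x B'0.
      move: sk; rewrite /s => sk.
      have : mdist x0 b <= rho.
        apply: hrho; split; first by case: Bb.
        exists a => //; have := mdist_tri b x a; rewrite (mdist_sym b x); lra.
      have := mdist_tri x b x0; rewrite (mdist_sym b x0); lra.
    have h : mdist x y / s x + mdist x z / s x < e.
      rewrite -mulrDl ltr_pdivrMr //; apply: (@lt_le_trans _ _ (2 * r)); first lra.
      by rewrite [e * _]mulrC; move: sk; rewrite /k ltr_pdivrMr // => /ltW.
    have := flip x y; have := flip x z; rewrite !ler_norml ltr_norml.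
    move=> /andP[? ?] /andP[? ?]; apply/andP; split; lra.
pose phi : Ch M := exist _ f hf.
(* [f] is 0 on [A] and 1 on [B'], so the coordinate of [p] would be within one half of both
   values. *)
have half : 0 < 2^-1 :> R by rewrite invr_gt0.
have [_ [[a Aa <-] /=]] := clp _ (nbhs_hspace p phi half).
rewrite /hemb /= /f setdist_mem // mul0r sub0r normrN => pa.
have : v (B' `&` [set m | `|sval phi m - p phi| < 2^-1]).
  by apply: filterI => //; exact: vp.
move=> /filter_ex[b [Bb /=]].
have -> : f b = 1.
  rewrite /f /s (setdist_mem Bb) addr0 divff //.
  by have := s0 b; rewrite /s (setdist_mem Bb) addr0 => /lt0r_neq0.
by move: pa; rewrite !ltr_norml => /andP[? ?] /andP[? ?]; lra.
Qed.

(** A single point is asymptotically disjoint from the whole space, so [asdisjoint_lim] excludes it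
    as a limit. *)
Lemma higson_lim_corona v p : unbounded_ultra v -> higson_lim v p -> corona M p.
Proof.
move=> vu vp; have [V _] := vu; split; last first.
  move=> [m _ mp].
  have vT : v setT by exact: filterT.
  have mb : asdisjoint setT [set m].
    apply: bounded_asdisjointr; exists 0 => a b -> ->; by rewrite mdistxx.
  apply: (asdisjoint_lim vu vp vT mb).
  by rewrite -mp; apply: subset_closure; exists m.
split; first by apply: higson_lim_closure => //; exact: filterT.
move=> phi; apply/andP; split; rewrite leNgt; apply/negP => lt.
  have : v [set m | `|sval phi m - p phi| < - p phi] by apply: vp; lra.
  move=> /filter_ex[m /=]; rewrite ltr_norml => /andP[_].
  have [_ /(_ m)/andP[? ?] _] := svalP phi; lra.
have : v [set m | `|sval phi m - p phi| < p phi - 1] by apply: vp; lra.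
move=> /filter_ex[m /=]; rewrite ltr_norml => /andP[? _].
have [_ /(_ m)/andP[? ?] _] := svalP phi; lra.
Qed.

Lemma traceP A p : corona M p -> trace A p <-> closure (@hemb M @` A) p.
Proof.
move=> cp; split; first by move=> [[]].
by move=> clp; split => //; split => //; case: cp.
Qed.

(** An unbounded part of [B] lies within some [r] of [A]. Moving an ultrafilter on it to [A] by a
    map of displacement at most [r] preserves the limit, because the coordinates oscillate
    slowly. *)
Lemma not_asdisjoint_lim A B : ~ asdisjoint B A -> exists v w p,
  [/\ unbounded_ultra v, unbounded_ultra w, v B, w A &
      higson_lim v p /\ higson_lim w p].
Proof.
move=> /existsNP[r nb]; set Z := (Z in bounded_set Z) in nb.
have [v vu vZ] := unbounded_ultra_exists nb; have [V bv] := vu.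
have h b : exists a, Z b -> A a /\ mdist b a <= r.
  have [[_ [a Aa ba]]|nZ] := pselect (Z b); first by exists a.
  by exists b.
have [c cP] := choice h.
have [p vp] := higson_lim_exists V.
exists v, [set S | v (c @^-1` S)], p; split => //.
- split; first exact: ultra_push.
  move=> S [s hs] /= vS; apply: (bv (c @^-1` S `&` Z)); last exact: filterI.
  exists (r + s + r) => a b [Sa /cP[_ ac]] [Sb /cP[_ bc]].
  have := hs _ _ Sa Sb; have := mdist_tri3 a (c a) (c b) b.
  rewrite (mdist_sym (c b)); lra.
- by apply: filterS vZ => b [].
- by rewrite /=; apply: filterS vZ => b /cP[].
split => // phi e e0.
have [z Zz] : exists z, Z z by exact: filter_ex vZ.
have r0 : 0 <= r by have [_ ?] := cP _ Zz; have := mdist_ge0 z (c z); lra.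
have [_ _ /(_ z (r + 1) (e / 2)) so] := svalP phi.
have [||D hD] := so; [lra|lra|].
have e2 : 0 < e / 2 by lra.
have := vp phi _ e2 => ve.
have vD : v (~` [set x | mdist z x <= D]).
  by apply: ultraC => //; apply: bv; apply: (@bounded_set_ball _ z _ D).
have : v ((Z `&` ~` [set x | mdist z x <= D]) `&`
    [set m | `|sval phi m - p phi| < e / 2]).
  by apply: filterI => //; exact: filterI.
rewrite /=; apply: filterS => b [[/cP[_ bc] far] /= be].
have Db : D <= mdist b z by rewrite mdist_sym; apply: ltW; rewrite ltNge; apply/negP.
have := hD b Db b (c b); rewrite mdistxx => H.
have {}H : `|sval phi b - sval phi (c b)| < e / 2 by apply: H; lra.
move: H be; rewrite !ltr_norml => /andP[? ?] /andP[? ?]; apply/andP; split; lra.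
Qed.

Lemma nbhs_closure_sub p (W : set (hspace M)) : nbhs p W ->
  exists2 W', nbhs p W' & closure W' `<=` W.
Proof.
by move=> pW; have [W' ? ?] := @uniform_regular (hspace M) p W pW; exists W'.
Qed.

Lemma higson_lim_nbhs_mem v p (W : set (hspace M)) : UltraFilter v ->
  higson_lim v p -> nbhs p W ->
  exists2 T, v T & forall w q, UltraFilter w -> w T -> higson_lim w q -> W q.
Proof.
move=> V vp /nbhs_closure_sub[W' pW' W'W].
exists (@hemb M @^-1` W'); first exact: (higson_lim_nbhs V vp pW').
move=> w q Uw wT wq; apply: W'W.
by apply: closure_subset (higson_lim_closure Uw wq wT) => _ [m ? <-].
Qed.

Lemma lim_asdisjoint v p A : unbounded_ultra v -> higson_lim v p ->
  ~ closure (@hemb M @` A) p -> exists2 B, v B & asdisjoint B A.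
Proof.
move=> vu vp nA; have [V _] := vu.
have [|B vB hB] := @higson_lim_nbhs_mem v p (~` closure (@hemb M @` A)) V vp.
  by apply: open_nbhs_nbhs; split => //; apply: closed_openC; exact: closed_closure.
exists B => //; apply: contrapT => /not_asdisjoint_lim[w [w' [q [[W _] [W' _] wB wA [wq w'q]]]]].
by apply: (hB w q) => //; exact: higson_lim_closure w'q wA.
Qed.

(** The two families consist of the sets away from [C] all of whose limits lie in [U1], respectively
    [U2]. Every limit of a set away from [C] lies in one of these open sets, and [ultra_compact]
    turns this into a finite decomposition. *)
Lemma separator_of_asymptotic v x A C : unbounded_ultra v -> higson_lim v x ->
  asymptotic_separator x A C -> separator setT v A C.
Proof.
move=> vu vx [_ [U1 [U2 [[ O1 oO1 eU1] [ O2 oO2 eU2] U12 cov [xU1 AU2]]]]].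
have [V _] := vu.
pose F0 (U : set (hspace M)) := [set S : set M |
  forall w p, unbounded_ultra w -> w S -> higson_lim w p -> U p].
pose F U := [set S | F0 U S /\ asdisjoint S C].
have UC p : U1 p \/ U2 p -> corona M p /\ ~ closure (@hemb M @` C) p.
  move=> Up; have [cp nt] : (corona M `\` trace C) p by rewrite cov.
  by split => // clp; apply: nt; apply/traceP.
have local (O U : set (hspace M)) w p : open O -> U = O `&` corona M ->
    unbounded_ultra w -> higson_lim w p -> U p -> exists2 T, w T & F0 U T.
  move=> oO -> wu wp [ Op _]; have [W _] := wu.
  have [|T wT hT] := @higson_lim_nbhs_mem w p O W wp; first exact: open_nbhs_nbhs.
  exists T => // w' q w'u w'T w'q; split; first by apply: (hT w' q) => //; case: w'u.
  exact: (higson_lim_corona w'u w'q).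
have F0S U S T : S `<=` T -> F0 U T -> F0 U S.
  move=> ST FT w p wu wS; apply: (FT w p) => //; have [W _] := wu.
  exact: filterS wS.
have F0U U S T : F0 U S -> F0 U T -> F0 U (S `|` T).
  move=> FS FT w p wu wST wp; have [W _] := wu.
  by have [wS|wT] := ultraU W wST; [apply: (FS w)|apply: (FT w)].
have F0b U S : bounded_set S -> F0 U S by move=> bS w p [_ /(_ _ bS)].
have F00 U : F0 U set0 by apply: F0b; exact: bounded_set0.
exists (F U1), (F U2); split.
- move=> S1 S2 [h1 _] [h2 _]; apply: contrapT.
  move=> /not_asdisjoint_lim[w [w' [p [wu w'u wS w'S [wp w'p]]]]].
  have : (U1 `&` U2) p by split; [apply: (h1 w)|apply: (h2 w')].
  by rewrite U12.
- move=> S _ SC.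
  have [|||T [T1 [T2 [FT1 FT2 sT]]] ST] := @ultra_compact M
    [set T | exists T1 T2, [/\ F0 U1 T1, F0 U2 T2 & T `<=` T1 `|` T2]] S.
  + by exists set0, set0; split; [exact: F00|exact: F00|move=> m []].
  + move=> T T' [T1 [T2 [? ? sT]]] [T1' [T2' [? ? sT']]].
    exists (T1 `|` T1'), (T2 `|` T2'); split; [exact: F0U|exact: F0U|].
    by move=> m [/sT[]|/sT'[]] ?; [left; left|right; left|left; right|right; right].
  + move=> w W wS; have [wu|nw] := pselect (unbounded_ultra w); last first.
      have [T bT wT] : exists2 T, bounded_set T & w T.
        apply: contrapT => nT; apply: nw; split => // T bT wT; apply: nT.
        by exists T.
      exists T => //; exists T, set0; split; [exact: F0b|exact: F00|].
      by move=> m; left.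
    have [p wp] := higson_lim_exists W; have cp := higson_lim_corona wu wp.
    have : (corona M `\` trace C) p.
      split => // /(traceP _ cp); exact: (asdisjoint_lim wu wp wS SC).
    rewrite cov => -[Up|Up].
      have [T wT FT] := local _ _ _ _ oO1 eU1 wu wp Up; exists T => //.
      by exists T, set0; split => // m; left.
    have [T wT FT] := local _ _ _ _ oO2 eU2 wu wp Up; exists T => //.
    by exists set0, T; split => // m; right.
  exists (S `&` T1), (S `&` T2); split.
  + by split; [apply: F0S FT1 => m []|apply: asdisjointSl SC => m []].
  + by split; [apply: F0S FT2 => m []|apply: asdisjointSl SC => m []].
  + rewrite -setIUr; apply/seteqP; split => m; last by case.
    by move=> Sm; split => //; exact/sT/ST.
- by move=> S [[]|[]].
- have xU : U1 x by exact: xU1.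
  have [T vT FT] := local _ _ _ _ oO1 eU1 vu vx xU.
  have [_ nC] := UC _ (or_introl xU).
  have [B vB BC] := lim_asdisjoint vu vx nC.
  exists (T `&` B); first exact: filterI.
  by split; [apply: F0S FT => m []|apply: asdisjointSl BC => m []].
- split.
    move=> w p wu wA wp; apply: AU2; have [W _] := wu.
    by apply/(traceP _ (higson_lim_corona wu wp)); exact: (higson_lim_closure _ wp wA).
  apply: contrapT => /not_asdisjoint_lim[w [w' [p [wu w'u wA w'C [wp w'p]]]]].
  have [W _] := wu; have [W' _] := w'u.
  have [|_] := UC p; last by apply; exact: higson_lim_closure w'p w'C.
  right; apply: AU2; apply/(traceP _ (higson_lim_corona wu wp)).
  exact: (higson_lim_closure _ wp wA).
Qed.

(** The consequence of properness that is used. Subspaces need not be proper, but this property also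
    holds on the uniformly separated subsets chosen later as separators. *)
Definition bounded_ultra_cvg := forall v K, UltraFilter v -> bounded_set K -> v K ->
  exists m, forall d : R, 0 < d -> v [set y | mdist m y < d].

Hypothesis bcvg : bounded_ultra_cvg.

(** If the ultrafilter contained a bounded set, it would converge to a point of [M], and by
    continuity [p] would be the image of that point. *)
Lemma corona_higson_lim p A : corona M p -> closure (@hemb M @` A) p ->
  exists v, [/\ unbounded_ultra v, v A & higson_lim v p].
Proof.
move=> [_ np] /closure_higson_lim[v [V vA vp]]; exists v; split => //; split => //.
move=> K bK vK; have [m hm] := bcvg V bK vK; apply: np; exists m => //.
apply: funext => phi; rewrite /hemb; apply: contrapT => /eqP.
rewrite -subr_eq0 -normr_gt0; set e := `|_| => e0; have e2 : 0 < e / 2 by lra.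
have [/(_ m _ e2)[d d0 hd] _ _] := svalP phi.
have : v ([set y | mdist m y < d] `&` [set y | `|sval phi y - p phi| < e / 2]).
  by apply: filterI; [exact: hm|exact: vp].
move=> /filter_ex[y [/hd h1 /= h2]].
have := ler_normD (sval phi m - sval phi y) (sval phi y - p phi).
rewrite addrA subrK -/e; lra.
Qed.

(** Each side of the partition is the open set [O F] of points that have some member of [F] as a
    neighbourhood. *)
Lemma asymptotic_of_separator v x A C : unbounded_ultra v -> higson_lim v x ->
  separator setT v A C -> asymptotic_separator x A C.
Proof.
move=> vu vx [F1 [F2 [F12 split12 FC [B vB F1B] F2A]]].
pose O (F : set (set M)) := \bigcup_(S in F) ~` closure (@hemb M @` (~` S)).
have oO F : open (O F).
  by apply: bigcup_open => S _; apply: closed_openC; exact: closed_closure.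
have Omem F w p : O F p -> unbounded_ultra w -> higson_lim w p ->
    exists2 S, F S & w S.
  move=> [S FS nS] [W _] wp; exists S => //; apply: contrapT => /(ultraC W) wS.
  by apply: nS; exact: (higson_lim_closure _ wp wS).
have pt p : corona M p -> exists2 w, unbounded_ultra w & higson_lim w p.
  move=> cp; have [|w [? _ ?]] := @corona_higson_lim p setT cp; last by exists w.
  by case: cp => -[].
have O12 p : corona M p -> O F1 p -> O F2 p -> False.
  move=> /pt[w wu wp] /Omem/(_ wu wp)[S1 F1S wS1] /Omem/(_ wu wp)[S2 F2S wS2].
  exact: (unbounded_asdisjoint wu (F12 _ _ F1S F2S) wS1 wS2).
have OC F p : (forall S, F S -> asdisjoint S C) -> corona M p -> O F p ->
    ~ closure (@hemb M @` C) p.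
  move=> FC' /pt[w wu wp] /Omem/(_ wu wp)[S FS wS].
  exact: (asdisjoint_lim wu wp wS (FC' _ FS)).
have cov p : corona M p -> ~ closure (@hemb M @` C) p -> O F1 p \/ O F2 p.
  move=> cp nC; have [w wu wp] := pt p cp; have [W _] := wu.
  have [|W' pW' W'C] := @nbhs_closure_sub p (~` closure (@hemb M @` C)).
    by apply: open_nbhs_nbhs; split => //; apply: closed_openC; exact: closed_closure.
  pose S := @hemb M @^-1` W'.
  have wS : w S by exact: (higson_lim_nbhs W wp pW').
  have SC : asdisjoint S C.
    apply: contrapT => /not_asdisjoint_lim[w1 [w2 [q [[W1 _] [W2 _] wq1 wq2 [h1 h2]]]]].
    apply: (W'C q); last exact: (higson_lim_closure _ h2 wq2).
    by apply: closure_subset (higson_lim_closure W1 h1 wq1) => _ [m ? <-].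
  have nS : ~ closure (@hemb M @` (~` S)) p.
    by move=> /(_ W' pW')[_ [[m nm <-] Wm]]; exact: nm.
  (* [S] is a neighbourhood of [p]; the piece [S1] is one too, since [p] does not adhere to the
     other piece. *)
  have side (S1 S2 : set M) : w S1 -> asdisjoint S1 S2 -> S `<=` S1 `|` S2 ->
      ~ closure (@hemb M @` (~` S1)) p.
    move=> wS1 S12 sS h.
    have : (closure (@hemb M @` (~` S)) `|` closure (@hemb M @` S2)) p.
      rewrite -closureU; apply: closure_subset h => _ [m nm <-].
      have [Sm|nSm] := pselect (S m); last by left; exists m.
      by right; have [//|S2m] := sS _ Sm; exists m.
    by case=> //; exact: (asdisjoint_lim wu wp wS1 S12).
  have [//|S1 [S2 [F1S F2S eS]]] := split12 S _ SC.
  have S12 := F12 _ _ F1S F2S.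
  have [w1|w2] : w S1 \/ w S2 by apply: ultraU => //; rewrite -eS.
    left; exists S1 => //; apply: (side S1 S2) => //; by rewrite eS.
  right; exists S2 => //; apply: (side S2 S1) => //; first exact: asdisjoint_sym.
  by rewrite eS setUC.
have cx := higson_lim_corona vu vx.
split; first by move=> p [].
exists (O F1 `&` corona M), (O F2 `&` corona M); split.
- by exists (O F1).
- by exists (O F2).
- by apply/seteqP; split => // p [[? ?] [? _]]; exact: (O12 p).
- apply/seteqP; split => p.
    move=> [cp nt]; have [||] := cov p cp; [|by left|by right].
    by move=> h; apply: nt; apply/traceP.
  move=> [[ Op cp]|[ Op cp]]; split => // /(traceP _ cp).
    by apply: OC Op => // S ?; apply: FC; left.
  by apply: OC Op => // S ?; apply: FC; right.
- split.
    move=> _ ->; split => //.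
    have [|//|O2] := cov x cx.
      exact: (asdisjoint_lim vu vx vB (FC B (or_introl F1B))).
    have [S F2S vS] := Omem _ _ _ O2 vu vx.
    by case: (unbounded_asdisjoint vu (F12 _ _ F1B F2S) vB vS).
  move=> p tp; have cp : corona M p by case: tp.
  have clA : closure (@hemb M @` A) p by apply/traceP.
  have [w [wu wA wp]] := corona_higson_lim cp clA.
  split => //; have [| O1|//] := cov p cp.
    exact: (asdisjoint_lim wu wp wA (FC A (or_intror F2A))).
  have [S F1S wS] := Omem _ _ _ O1 wu wp.
  by case: (unbounded_asdisjoint wu (F12 _ _ F1S F2A) wS wA).
Qed.

End Dictionary.

(** * Comparison with asind and trasind *)

Section Transport.
Variables (X M : metric) (i : M -> X).
Hypothesis iso : forall x y, mdist (i x) (i y) = mdist x y.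

Lemma iso_inj : injective i.
Proof. by move=> x y e; apply/mdist_eq0; rewrite -iso e mdistxx. Qed.

Lemma iso_bounded (S : set M) : bounded_set (i @` S) <-> bounded_set S.
Proof.
split=> -[r h]; exists r.
  by move=> a b Sa Sb; rewrite -iso; apply: h; [exists a|exists b].
by move=> _ _ [a Sa <-] [b Sb <-]; rewrite iso; exact: h.
Qed.

Lemma iso_asdisjoint (A B : set M) :
  asdisjoint (i @` A) (i @` B) <-> asdisjoint A B.
Proof.
split=> h r.
  apply/iso_bounded; apply: bounded_setS (h r) => _ [a [Aa [b Bb ab]] <-].
  by split; [exists a|exists (i b); [exists b|rewrite iso]].
have /iso_bounded := h r; apply: bounded_setS.
move=> _ [[a Aa <-] [_ [b Bb <-] ab]]; exists a => //; split => //.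
by exists b => //; rewrite -iso.
Qed.

Lemma unbounded_pull (u : set_system X) : unbounded_ultra u -> u (range i) ->
  unbounded_ultra [set S | u (i @` S)].
Proof.
move=> [U bu] ui; split; last by move=> S /iso_bounded bS; exact: bu.
apply: ultra_intro => [|S /=].
  split; first by rewrite /= image_set0; exact: filter_not_empty.
  split => //=; last by move=> S T ST; apply: filterS; exact: image_subset.
  move=> S T /= uS uT; have : u (i @` S `&` i @` T) by exact: filterI.
  apply: filterS => _ [[a Sa <-] [b Tb /iso_inj eab]].
  by exists a => //; split => //; rewrite -eab.
have [uS|uS] := in_ultra_setVsetC (i @` S) U; [by left|right].
have : u (~` (i @` S) `&` range i) by exact: filterI.
apply: filterS => x [nS [a _ ea]]; exists a => // Sa; apply: nS.
by exists a.
Qed.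

Lemma unbounded_isopush (v : set_system M) : unbounded_ultra v ->
  unbounded_ultra [set S | v (i @^-1` S)].
Proof.
move=> [V bv]; split; first exact: ultra_push.
move=> S bS /=; apply: bv; apply/iso_bounded; apply: bounded_setS bS.
by move=> _ [a ? <-].
Qed.

Lemma separator_image (u : set_system X) (A C : set M) :
  separator setT [set S | u (i @` S)] A C ->
  separator (range i) u (i @` A) (i @` C).
Proof.
move=> [F1 [F2 [F12 split12 FC [B uB F1B] F2A]]].
exists [set i @` S | S in F1], [set i @` S | S in F2]; split.
- by move=> _ _ [S1 ? <-] [S2 ? <-]; apply/iso_asdisjoint; exact: F12.
- move=> S Si SC.
  have eS : S = i @` (i @^-1` S).
    apply/seteqP; split => [x Sx|_ [a ? <-]//].
    by have [a _ ea] := Si _ Sx; exists a => //=; rewrite ea.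
  have [//||S1 [S2 [F1S F2S e12]]] := split12 (i @^-1` S).
    by apply/iso_asdisjoint; rewrite -eS.
  exists (i @` S1), (i @` S2); split; [by exists S1|by exists S2|].
  by rewrite -image_setU -e12 -eS.
- by move=> S [[T FT <-]|[T FT <-]]; apply/iso_asdisjoint/FC; [left|right].
- by exists (i @` B) => //; exists B.
- by exists A.
Qed.

Lemma separator_preimage (v : set_system M) (A : set M) (E : set X) :
  separator (range i) [set S | v (i @^-1` S)] (i @` A) E -> E `<=` range i ->
  separator setT v A (i @^-1` E).
Proof.
move=> [F1 [F2 [F12 split12 FE [B vB F1B] F2A]]] Ei.
have iE : i @` (i @^-1` E) = E.
  apply/seteqP; split => [_ [a ? <-]//|x Ex].
  by have [a _ ea] := Ei _ Ex; exists a => //=; rewrite ea.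
pose F (G : set (set X)) := [set S : set M | exists2 S', G S' & i @` S `<=` S'].
exists (F F1), (F F2); split.
- move=> S1 S2 [T1 F1T s1] [T2 F2T s2]; apply/iso_asdisjoint.
  exact: asdisjointSS (F12 _ _ F1T F2T).
- move=> S _ /iso_asdisjoint; rewrite iE => SE.
  have [|S1 [S2 [F1S F2S e12]]] := split12 _ _ SE; first by move=> _ [a _ <-]; exists a.
  exists (S `&` i @^-1` S1), (S `&` i @^-1` S2); split.
  + by exists S1 => // _ [a [_ ?] <-].
  + by exists S2 => // _ [a [_ ?] <-].
  + apply/seteqP; split => [a Sa|a [] []//].
    have : (i @` S) (i a) by exists a.
    by rewrite e12 => -[|] ?; [left|right].
- move=> S FS; apply/iso_asdisjoint; rewrite iE.
  case: FS => -[T FT sT]; apply: (asdisjointSl sT); apply: FE; by [left|right].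
- by exists (i @^-1` B) => //; exists B => // _ [a ? <-].
- by exists (i @` A).
Qed.

End Transport.

(** Asymptotic disjointness ignores bounded displacement, so a separator may be thinned to a net. *)
Lemma separator_net (X : metric) (Y A E E' : set X) (u : set_system X) (r : R) :
  E' `<=` E -> (forall x, E x -> exists2 e, E' e & mdist x e < r) ->
  separator Y u A E -> separator Y u A E'.
Proof.
move=> E'E net [F1 [F2 [F12 split12 FE uB F2A]]].
exists F1, F2; split => //.
  move=> S SY SE'; apply: split12 => // s; apply: bounded_setS (SE' (s + r)).
  move=> x [Sx [y /net[e Ee ye] xy]]; split => //; exists e => //.
  have := mdist_tri x y e; lra.
by move=> S /FE; apply: asdisjointSr.
Qed.

Lemma mbounded_set (M : metric) : mbounded M <-> bounded_set [set: M].
Proof.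
by split=> -[r h]; exists r => a b; [move=> _ _; exact: h|exact: h].
Qed.

Lemma trasind_leE (W : Type) (lt : W -> W -> Prop) (wf : well_founded lt)
    (alpha : W) (M : metric) :
  trasind_le wf alpha M ->
  forall (x : hspace M) (A : set M), corona M x -> ~ trace A x ->
    exists C : set M, asymptotic_separator x A C /\
      (mbounded (sub C) \/
       exists beta, lt beta alpha /\ trasind_le wf beta (sub C)).
Proof.
rewrite /trasind_le Fix_eq; last first.
  move=> a f g fg; suff -> : f = g by [].
  apply: functional_extensionality_dep => b.
  by apply: functional_extensionality_dep => h; exact: fg.
move=> h x A cx nA; have [C [sC [bC|[b [ba hb]]]]] := h x A cx nA.
  by exists C; split => //; left.
by exists C; split => //; right; exists b.
Qed.

Lemma range_sub (X M : metric) (i : M -> X) (C : set M) :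
  range (fun y : sub C => i (sval y)) = i @` C.
Proof.
apply/seteqP; split => [_ [[y Cy] _ <-]|_ [y Cy <-]]; first by exists y.
by exists (exist _ y Cy).
Qed.

(** Transfinite induction: the separators have smaller index, hence finite [cind], and
    [cind_bounded] makes the bound uniform. The embedding [i] keeps all iterated subspaces inside
    one [X]. *)
Lemma trasind_cind (X : metric) (W : Type) (lt : W -> W -> Prop)
    (wf : well_founded lt) (alpha : W) (M : metric) (i : M -> X) :
  (forall x y, mdist (i x) (i y) = mdist x y) ->
  trasind_le wf alpha M -> exists n, cind n (range i).
Proof.
elim/(well_founded_ind wf): alpha M i => alpha IH M i iso tM.
apply: cind_bounded => u uu ui A Ai [B uB BA].
have vu := unbounded_pull iso uu ui; have [V _] := vu; have [U _] := uu.
have [x vx] := higson_lim_exists V; have cx := higson_lim_corona vu vx.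
have eA : i @` (i @^-1` A) = A.
  apply/seteqP; split => [_ [a ? <-]//|y Ay].
  by have [a _ ea] := Ai _ Ay; exists a => //=; rewrite ea.
have nA : ~ trace (i @^-1` A) x.
  move=> /(traceP _ cx); apply: (@asdisjoint_lim _ _ _ _ (i @^-1` B) vu vx).
    have : u (B `&` range i) by exact: filterI.
    by apply: filterS => y [Bb [b _ eb]]; exists b => //=; rewrite eb.
  apply/(iso_asdisjoint iso); rewrite eA; apply: asdisjointSl BA.
  by move=> _ [b ? <-].
have [C [sC dC]] := trasind_leE tM cx nA.
exists (i @` C); split; first by move=> _ [c _ <-]; exists c.
  rewrite -eA; apply: (separator_image iso).
  exact: (separator_of_asymptotic vu vx sC).
have iso' (y z : sub C) : mdist (i (sval y)) (i (sval z)) = mdist y z by exact: iso.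
rewrite -range_sub; case: dC => [/mbounded_set bC|[b [ba tb]]].
  by exists 0%N; apply/(iso_bounded iso').
exact: (IH b ba (sub C) (fun y => i (sval y)) iso' tb).
Qed.

(** Without a limit, a closed ball in [v] would be covered by finitely many open sets outside
    [v]. *)
Lemma proper_bounded_ultra_cvg (X : metric) : mproper X -> bounded_ultra_cvg X.
Proof.
move=> pX v K V bK vK.
have [x0 _] : exists x0, K x0 by exact: filter_ex vK.
have [r hr] := bounded_set_in_ball x0 bK.
apply: contrapT => nm.
have [|x _|s [sF Ks]] := pX x0 r [set U | mopen U /\ ~ v U].
- by move=> U [].
- have [d d0 nd] : exists2 d : R, 0 < d & ~ v [set y | mdist x y < d].
    apply: contrapT => nd; apply: nm; exists x => d d0; apply: contrapT => nv.
    by apply: nd; exists d.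
  exists [set y | mdist x y < d]; last by rewrite /= mdistxx.
  split => // y /= xy; exists (d - mdist x y); first by rewrite subr_gt0.
  by move=> z yz; have := mdist_tri x y z; rewrite /=; lra.
- have : v [set x | exists2 U, U \in s & U x].
    by apply: filterS vK => y /hr/Ks.
  elim: s sF {Ks} => [|U s IH] sF vs.
    by have [y [U]] := filter_ex vs.
  have : v (U `|` [set x | exists2 U, U \in s & U x]).
    apply: filterS vs => y [W]; rewrite inE => /orP[/eqP ->|Ws] Wy; first by left.
    by right; exists W.
  move=> /(ultraU V)[vU|].
    by have [_] := sF U (mem_head _ _); apply.
  by apply: IH => W Ws; apply: sF; rewrite inE Ws orbT.
Qed.

(** The limit exists in [X], and at most one point of [M] has its image within one half of it; so
    [v] is principal. *)
Lemma separated_bounded_ultra_cvg (X M : metric) (i : M -> X) :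
  bounded_ultra_cvg X -> (forall x y, mdist (i x) (i y) = mdist x y) ->
  (forall x y : M, x <> y -> 1 <= mdist x y) -> bounded_ultra_cvg M.
Proof.
move=> cX iso sep v K V bK vK.
have bK' : bounded_set (i @` K) by apply/(iso_bounded iso).
have [||m hm] := cX [set S | v (i @^-1` S)] _ _ bK'; first exact: ultra_push.
  by rewrite /=; apply: filterS vK => y ?; exists y.
have half : 0 < 2^-1 :> R by rewrite invr_gt0.
have vm : v [set y | mdist m (i y) < 2^-1] by exact: (hm _ half).
have [y0 /= my0] := filter_ex vm; exists y0 => d d0.
apply: filterS vm => y /= my.
have [->|/eqP ne] := eqVneq (y : {classic M}) y0; first by rewrite mdistxx.
have := sep _ _ ne; rewrite -iso; have := mdist_tri (i y) m (i y0).
rewrite (mdist_sym (i y) m); lra.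
Qed.

(** Each separator is thinned to a 1-separated net before recursing, so that [bounded_ultra_cvg] is
    inherited; monotonicity of [cind] keeps the bound for the net. *)
Lemma cind_asind (X : metric) n (M : metric) (i : M -> X) :
  bounded_ultra_cvg X -> bounded_ultra_cvg M ->
  (forall x y, mdist (i x) (i y) = mdist x y) ->
  cind n (range i) -> asind_le n M.
Proof.
move=> cX; elim: n M i => [|n IH] M i cM iso.
  by move=> /(iso_bounded iso)/mbounded_set.
move=> dM x A cx nA.
have [|v [vu _ vx]] := @corona_higson_lim M cM x setT cx; first by case: cx => -[].
have [V _] := vu.
have nclA : ~ closure (@hemb M @` A) x by move=> h; apply: nA; apply/traceP.
have [B vB BA] := lim_asdisjoint vu vx nclA.
have uu := unbounded_isopush iso vu.
have [|||E [Ei sE dE]] := dM _ uu _ (i @` A).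
- by rewrite /=; apply: filterS (@filterT _ v _) => y _; exists y.
- by move=> _ [a _ <-]; exists a.
- exists (i @` B); last by apply/(iso_asdisjoint iso).
  by rewrite /=; apply: filterS vB => y ?; exists y.
have [E' [E'E sep net]] := separated_net id E (@ltr01 R).
have E'i : E' `<=` range i by move=> y /E'E/Ei.
pose C := i @^-1` E'.
have eC : i @` C = E'.
  apply/seteqP; split => [_ [a ? <-]//|y Ey].
  by have [a _ ea] := E'i _ Ey; exists a => //; rewrite /C /= ea.
have iso' (y z : sub C) : mdist (i (sval y)) (i (sval z)) = mdist y z by exact: iso.
exists C; split.
  apply: (asymptotic_of_separator cM vu vx); apply: (separator_preimage iso) => //.
  exact: separator_net E'E net sE.
apply: (IH (sub C) (fun y => i (sval y))) => //.
  apply: (separated_bounded_ultra_cvg cX iso') => y z yz; rewrite -iso'.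
  apply: sep; [exact: (svalP y)|exact: (svalP z)|].
  by move=> e; apply: yz; apply/mdist_eq0; rewrite -iso' e mdistxx.
by rewrite range_sub eC; exact: cindSS dE.
Qed.

Theorem theorem1 (X : metric) :
  mproper X -> trasind_finite X -> exists n : nat, asind_le n X.
Proof.
move=> pX [W [lt [wo [alpha tX]]]].
have [n dX] := @trasind_cind X _ _ _ _ X id (fun _ _ => erefl) tX.
exists n; have cX := proper_bounded_ultra_cvg pX.
exact: (cind_asind cX cX (fun _ _ => erefl) dX).
Qed.
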